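(* Let $r\ge2$ and consider the partitioning problem $$\min_{\mathbf{P},\,\boldsymbol{\epsilon}}\ N\big(\mathbf{P},\boldsymbol{\epsilon},\tfrac{\beta}{|\mathbf{P}|}\mathbf{1}\big)\quad\text{subject to}\quad\boldsymbol{\epsilon}>0,\ \mathbf{1}^\top\boldsymbol{\epsilon}\le\epsilon,\ \mathbf{P}\text{ is a partition of }\{1,\dots,r\}.$$ The efficient partitioning algorithm (described in the context) returns $\mathbf{P}^\star,\boldsymbol{\epsilon}^\star$, a feasible solution of this problem, with a number of evaluations of $\gamma$ which is polynomial in $r$. Moreover, if $\gamma$ is submodular, then the solution has a $(2-2/r)^2$-approximation guarantee, i.e. $N(\mathbf{P}^\star,\boldsymbol{\epsilon}^\star,\tfrac{\beta}{|\mathbf{P}^\star|}\mathbf{1})$ is at most $(2-2/r)^2$ times the optimal value of the problem.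
   Context: Setting. Consider the chance constrained program $\min_{(\mathbf{x},\mathbf{y})\in\mathbf{V}}c^\top\mathbf{x}$ subject to $\mathbb{P}[f(\mathbf{x},\mathbf{y},\mathbf{w})\le0]\ge1-\epsilon$, where $\mathbf{V}\subseteq\mathbb{R}^n\times\{0,1\}^b$ is compact and convex for fixed $\mathbf{y}$; $c\in\mathbb{R}^n$; $\epsilon\in(0,1)$; $\mathbf{w}$ is an uncertain parameter over a probability space $(\mathbf{W},\mathcal{F},\mathbb{P})$; $f:\mathbb{R}^n\times\{0,1\}^b\times\mathbf{W}\to\mathbb{R}^r$ has components $f_1,\dots,f_r$ and is convex in $\mathbf{x}$ for all $\mathbf{w}\in\mathbf{W}$ and all $\mathbf{y}\in\{0,1\}^b$ for which some $(\mathbf{x},\mathbf{y})\in\mathbf{V}$ exists. $\mathcal{J}=\{1,\dots,r\}$, and $\beta\in(0,1/e)$. Support rank. Let $\mathcal{L}$ be the set of all linear subspaces of $\mathbb{R}^n$. For a function $g(\mathbf{x},\mathbf{y},\mathbf{w})$ let $F_g(\mathbf{x},\mathbf{y},\mathbf{w}):=\{\xi\in\mathbb{R}^n: g(\mathbf{x}+\xi,\mathbf{y},\mathbf{w})=g(\mathbf{x},\mathbf{y},\mathbf{w})\}$ and $\mathcal{L}_g:=\bigcap_{(\mathbf{x},\mathbf{y},\mathbf{w})\in\mathbf{V}\times\mathbf{W}}\{L\in\mathcal{L}: L\subseteq F_g(\mathbf{x},\mathbf{y},\mathbf{w})\}$. For $\mathcal{A}\subseteq\mathcal{J}$, $L_{\mathcal{A}}$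 is the maximal element (with respect to inclusion) of $\mathcal{L}_g$ with $g=\max_{j\in\mathcal{A}}f_j$, and $\rho(\mathcal{A}):=n-\dim(L_{\mathcal{A}})$; by convention $\rho(\emptyset)=0$. Cost. $\nu:2^{\mathcal{J}}\to\mathbb{R}_{\ge0}$ is a monotone modular set function (marginals $\nu(\mathcal{A}\cup\{j\})-\nu(\mathcal{A})$, $j\notin\mathcal{A}$, do not depend on $\mathcal{A}$) with $\nu(\{j\})>0$ for all $j\in\mathcal{J}$. For a partition $\mathbf{P}=\{\mathcal{P}_i\}_{i=1}^P$ into nonempty parts, $$N(\mathbf{P},\boldsymbol{\epsilon},\boldsymbol{\beta}):=\frac{e}{e-1}\sum_{i=1}^P\frac{1}{\epsilon_i}\Big(\ln\Big(\frac{2^b}{\beta_i}\Big)+\rho(\mathcal{P}_i)-1\Big)\nu(\mathcal{P}_i).$$ For given partition size $P$, $\sigma(\mathcal{A}):=\big(\ln(\tfrac{2^bP}{\beta})+\rho(\mathcal{A})-1\big)\nu(\mathcal{A})$ and $\gamma(\mathcal{A}):=\sqrt{\sigma(\mathcal{A})}$ (so $\gamma$ depends on $P$; ''$\gamma$ is submodular'' means that this holds for every $P\in\{2,\dots,r\}$). A set function $\gamma$ is submodular if $\gamma(\mathcal{A}\cup\{j\})-\gamma(\mathcal{A})\ge\gamma(\mathcal{B}\cup\{j\})-\gamma(\mathcal{B})$ for all $\mathcal{A}\subseteq\mathcal{B}\subset\mathcal{J}$, $j\in\mathcal{J}\setminus\mathcal{B}$. For a partition $\mathbf{P}$ of size $P$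 put $\epsilon_i^\star(\mathbf{P}):=\epsilon\sqrt{\sigma(\mathcal{P}_i)}\big/\sum_{j=1}^P\sqrt{\sigma(\mathcal{P}_j)}$. Efficient partitioning algorithm. Initialize $\mathbf{P}^\star\leftarrow\{\mathcal{J}\}$, $N^\star\leftarrow N(\{\mathcal{J}\},\epsilon,\beta)$. For $P=2,\dots,r$: let $\mathbf{P}\leftarrow\mathrm{GSA}(P,\gamma)$ and $\overline{N}\leftarrow N(\mathbf{P},\boldsymbol{\epsilon}^\star(\mathbf{P}),\tfrac{\beta}{P}\mathbf{1})$; if $\overline{N}<N^\star$ then set $\mathbf{P}^\star\leftarrow\mathbf{P}$, $N^\star\leftarrow\overline{N}$. Return $\mathbf{P}^\star$ and $\boldsymbol{\epsilon}^\star:=\boldsymbol{\epsilon}^\star(\mathbf{P}^\star)$. $\mathrm{GSA}(P,\gamma)$ is the greedy splitting algorithm of Zhao, Nagamochi and Ibaraki: start from $\{\mathcal{J}\}$ and, $P-1$ times, replace a part $W$ of the current partition by the two parts $X$, $W\setminus X$, where the pair $(X,W)$, $\emptyset\ne X\subsetneq W$, is chosen to minimize $\gamma(X)+\gamma(W\setminus X)-\gamma(W)$. For each part $W$ with $|W|\ge2$ the candidate $X$ is computed by Queyranne's algorithm applied to the symmetric function $h(X)=\gamma(X)+\gamma(W\setminus X)$ (this is exact when $\gamma$ is submodular; otherwise the algorithm is run in the same way and just yields some candidate $X$): keep a partition of $W$ into groups, initially singletons; while there are at least two groups, order them by starting from an arbitrary group and repeatedly appending a remaining group $U$ minimizing $h(A\cup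 U)-h(U)$, where $A$ is the union of the groups already ordered; record the last group in the order as a candidate for $X$ and merge the last two groups; finally return a recorded candidate of smallest $h$-value. *)

(* Defs.v *)
From HB Require Import structures.
From mathcomp Require Import all_boot all_order all_algebra.
From mathcomp Require Import all_classical all_reals all_analysis.

Set Implicit Arguments.
Unset Strict Implicit.
Unset Printing Implicit Defensive.

Import Order.TTheory GRing.Theory Num.Theory.
Import numFieldNormedType.Exports.

Local Open Scope ring_scope.

(* The component f_j(x, y, w) is [ccp_constr x y w ord0 j]; binary vectors are
   rows over [bool], with the discrete topology.  The objective vector and the
   probability do not enter the partitioning problem. *)
Record ccp (R : realType) (n b r : nat) (d : measure_display)
    (W : measurableType d) := Ccp {
  ccp_obj : 'rV[R]_n ;
  ccp_dom : set ('rV[R]_n * 'rV[bool]_b) ;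
  ccp_prob : probability W R ;
  ccp_eps : R ;
  ccp_constr : 'rV[R]_n -> 'rV[bool]_b -> W -> 'rV[R]_r ;
  ccp_dom_compact : compact ccp_dom ;
  ccp_dom_convex : forall y, convex_set [set x | ccp_dom (x, y)]%classic ;
  ccp_eps_gt0 : 0 < ccp_eps ;
  ccp_eps_lt1 : ccp_eps < 1 ;
  ccp_constr_convex : forall y w j, (exists x, ccp_dom (x, y)) ->
    convex_function [set: 'rV[R]_n]%classic
      (fun x => ccp_constr x y w ord0 j) }.

(* g = max_{j in A} f_j; the maximum is taken in [\bar R] only because a
   maximum over a set of reals needs a neutral element, and it is finite for
   nonempty A. *)
Definition max_constr (R : realType) (n b r : nat) (d : measure_display)
    (W : measurableType d) (C : ccp R n b r W) (A : {set 'I_r})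
    (x : 'rV[R]_n) (y : 'rV[bool]_b) (w : W) : \bar R :=
  \big[maxe/-oo%E]_(j in A) (ccp_constr C x y w ord0 j)%:E.

Definition flat_set (T : Type) (R : realType) (n b : nat) (W : Type)
    (g : 'rV[R]_n -> 'rV[bool]_b -> W -> T)
    (x : 'rV[R]_n) (y : 'rV[bool]_b) (w : W) : set 'rV[R]_n :=
  [set xi | g (x + xi) y w = g x y w]%classic.

Definition flat_spaces (R : realType) (n b r : nat) (d : measure_display)
    (W : measurableType d) (C : ccp R n b r W) (A : {set 'I_r}) :
    set {vspace 'rV[R]_n} :=
  [set L | forall x y w, ccp_dom C (x, y) ->
     [set` L] `<=` flat_set (max_constr C A) x y w]%classic.

(* By convexity there is exactly one maximal element when A is nonempty, so
   the choice made by [xget] is immaterial. *)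
Definition max_flat_space (R : realType) (n b r : nat) (d : measure_display)
    (W : measurableType d) (C : ccp R n b r W) (A : {set 'I_r}) :
    {vspace 'rV[R]_n} :=
  xget 0%VS
    [set L | flat_spaces C A L /\
       forall L', flat_spaces C A L' -> (L <= L')%VS -> L' = L]%classic.

Definition support_rank (R : realType) (n b r : nat) (d : measure_display)
    (W : measurableType d) (C : ccp R n b r W) (A : {set 'I_r}) : nat :=
  if A == finset.set0 then 0%N else (n - \dim (max_flat_space C A))%N.

Definition monotone_setfun (R : realType) (r : nat)
    (nu : {set 'I_r} -> R) : Prop :=
  forall A B : {set 'I_r}, A \subset B -> nu A <= nu B.

Definition modular_setfun (R : realType) (r : nat)
    (nu : {set 'I_r} -> R) : Prop :=
  forall (A B : {set 'I_r}) (j : 'I_r), j \notin A -> j \notin B ->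
    nu (j |: A)%SET - nu A = nu (j |: B)%SET - nu B.

Definition submodular_setfun (R : realType) (r : nat)
    (g : {set 'I_r} -> R) : Prop :=
  forall (A B : {set 'I_r}) (j : 'I_r), A \subset B -> j \notin B ->
    g (j |: B)%SET - g B <= g (j |: A)%SET - g A.

(* Vectors indexed by the parts of a partition are functions of the part. *)
Definition sampling_cost (R : realType) (n b r : nat) (d : measure_display)
    (W : measurableType d) (C : ccp R n b r W) (nu : {set 'I_r} -> R)
    (P : {set {set 'I_r}}) (eps beta : {set 'I_r} -> R) : R :=
  expR 1 / (expR 1 - 1) *
  \sum_(A in P) 1 / eps A *
     (ln (2 ^+ b / beta A) + (support_rank C A)%:R - 1) * nu A.

Definition objective (R : realType) (n b r : nat) (d : measure_display)
    (W : measurableType d) (C : ccp R n b r W) (nu : {set 'I_r} -> R)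
    (beta : R) (s : {set {set 'I_r}} * ({set 'I_r} -> R)) : R :=
  sampling_cost C nu s.1 s.2 (fun=> beta / #|s.1|%:R).

Definition feasible (R : realType) (n b r : nat) (d : measure_display)
    (W : measurableType d) (C : ccp R n b r W)
    (s : {set {set 'I_r}} * ({set 'I_r} -> R)) : Prop :=
  [/\ finset.partition s.1 [set: 'I_r]%SET,
      forall A, A \in s.1 -> 0 < s.2 A
    & \sum_(A in s.1) s.2 A <= ccp_eps C].

Definition optimal_value (R : realType) (n b r : nat) (d : measure_display)
    (W : measurableType d) (C : ccp R n b r W) (nu : {set 'I_r} -> R)
    (beta : R) : R :=
  inf [set objective C nu beta s | s in feasible C]%classic.

Definition sigma (R : realType) (n b r : nat) (d : measure_display)
    (W : measurableType d) (C : ccp R n b r W) (nu : {set 'I_r} -> R)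
    (beta : R) (p : nat) (A : {set 'I_r}) : R :=
  (ln (2 ^+ b * p%:R / beta) + (support_rank C A)%:R - 1) * nu A.

Definition gamma (R : realType) (n b r : nat) (d : measure_display)
    (W : measurableType d) (C : ccp R n b r W) (nu : {set 'I_r} -> R)
    (beta : R) (p : nat) (A : {set 'I_r}) : R :=
  Num.sqrt (sigma C nu beta p A).

(* A program asks queries in Q, answered in S, and may choose an arbitrary
   element of a list; this is how "arbitrary" choices and ties in minimizations
   are rendered. *)
Inductive prog (Q S A : Type) : Type :=
| Ret of A
| Ask of Q & (S -> prog Q S A)
| Choose (T : eqType) of seq T & (T -> prog Q S A).
Arguments Ret {Q S A}.
Arguments Ask {Q S A}.
Arguments Choose {Q S A T}.

Fixpoint bind (Q S A B : Type) (c : prog Q S A) (f : A -> prog Q S B) :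
    prog Q S B :=
  match c with
  | Ret a => f a
  | Ask q k => Ask q (fun s => bind (k s) f)
  | Choose T l k => Choose l (fun t => bind (k t) f)
  end.

Notation "x <~ c ;; k" := (bind c (fun x => k))
  (at level 100, c at next level, right associativity).

(* Every execution of c, started with k units already spent, terminates
   normally (in particular it never has to choose from an empty list) with a
   result a and a total cost k' such that [post a k']. *)
Fixpoint every_run (Q S A : Type) (answer : Q -> S) (cost : Q -> nat)
    (c : prog Q S A) (k : nat) (post : A -> nat -> Prop) : Prop :=
  match c with
  | Ret a => post a k
  | Ask q c' => every_run answer cost (c' (answer q)) (k + cost q)%N post
  | Choose T l c' =>
      l <> [::] /\
      forall t, t \in l -> every_run answer cost (c' t) k post
  end.

Fixpoint mapP (Q S A B : Type) (f : A -> prog Q S B) (l : seq A) :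
    prog Q S (seq B) :=
  if l is a :: l' then
    x <~ f a ;; xs <~ mapP f l' ;; Ret (x :: xs)
  else Ret [::].

Fixpoint foldP (Q S A B : Type) (f : B -> A -> prog Q S B) (z : B)
    (l : seq A) : prog Q S B :=
  if l is a :: l' then z' <~ f z a ;; foldP f z' l' else Ret z.

Fixpoint iterP (Q S A : Type) (m : nat) (f : A -> prog Q S A) (z : A) :
    prog Q S A :=
  if m is m'.+1 then z' <~ f z ;; iterP m' f z' else Ret z.

Definition pick_any (Q S : Type) (T : eqType) (l : seq T) : prog Q S T :=
  Choose l Ret.
Arguments pick_any {Q S T}.

Definition pick_min (R : realType) (Q S : Type) (T : eqType)
    (key : T -> prog Q S R) (l : seq T) : prog Q S T :=
  l' <~ mapP (fun t => v <~ key t ;; Ret (t, v)) l ;;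
  t <~ pick_any [seq p <- l' | all (fun q => p.2 <= q.2) l'] ;;
  Ret t.1.

(* The program knows r, ccp_eps and beta; the data rho and nu are only
   accessible through these queries. *)
Inductive query (R : realType) (r : nat) : Type :=
| QGamma of nat & {set 'I_r}
| QCost of {set {set 'I_r}} & ({set 'I_r} -> R) & ({set 'I_r} -> R).
Arguments QGamma {R r}.

Definition answer (R : realType) (n b r : nat) (d : measure_display)
    (W : measurableType d) (C : ccp R n b r W) (nu : {set 'I_r} -> R)
    (beta : R) (q : query R r) : R :=
  match q with
  | QGamma p A => gamma C nu beta p A
  | QCost P eps bet => sampling_cost C nu P eps bet
  end.

(* Number of evaluations of gamma.  Evaluating N on a partition involves rho
   and nu once per part, and is charged as one evaluation per part. *)
Definition query_cost (R : realType) (r : nat) (q : query R r) : nat :=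
  match q with
  | QGamma _ _ => 1%N
  | QCost P _ _ => #|P|
  end.

Definition program (R : realType) (r : nat) (A : Type) : Type :=
  prog (query R r) R A.

Definition ask_gamma (R : realType) (r p : nat) (A : {set 'I_r}) :
    program R r R :=
  Ask (QGamma p A) Ret.

Definition ask_cost (R : realType) (r : nat) (P : {set {set 'I_r}})
    (eps bet : {set 'I_r} -> R) : program R r R :=
  Ask (QCost P eps bet) Ret.

Definition sym_cut (R : realType) (r p : nat) (W X : {set 'I_r}) :
    program R r R :=
  u <~ ask_gamma R p X ;; v <~ ask_gamma R p (W :\: X)%SET ;; Ret (u + v).

(* The ordered groups are listed with the most recent one first; the second
   component lists the remaining groups. *)
Definition append_group (R : realType) (r p : nat) (W : {set 'I_r})
    (st : seq {set 'I_r} * seq {set 'I_r}) :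
    program R r (seq {set 'I_r} * seq {set 'I_r}) :=
  let A := (\bigcup_(G <- st.1) G)%SET in
  U <~ pick_min (fun U => u <~ sym_cut R p W (A :|: U)%SET ;;
                         v <~ sym_cut R p W U ;; Ret (u - v)) st.2 ;;
  Ret (U :: st.1, rem U st.2).

Definition order_groups (R : realType) (r p : nat) (W : {set 'I_r})
    (groups : seq {set 'I_r}) : program R r (seq {set 'I_r}) :=
  G <~ pick_any groups ;;
  st <~ iterP (size groups).-1 (append_group R p W) ([:: G], rem G groups) ;;
  Ret st.1.

(* State: the current groups and the candidates recorded so far. *)
Definition merge_step (R : realType) (r p : nat) (W : {set 'I_r})
    (st : seq {set 'I_r} * seq {set 'I_r}) :
    program R r (seq {set 'I_r} * seq {set 'I_r}) :=
  ord <~ order_groups R p W st.1 ;;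
  Ret (if ord is U :: U' :: rest
       then ((U :|: U')%SET :: rest, U :: st.2) else st).

(* Each step decreases the number of groups by one, so that [#|W|.-1] steps
   lead from singletons to a single group. *)
Definition queyranne (R : realType) (r p : nat) (W : {set 'I_r}) :
    program R r {set 'I_r} :=
  st <~ iterP #|W|.-1 (merge_step R p W)
          ([seq [set x]%SET | x <- enum W], [::]) ;;
  pick_min (sym_cut R p W) st.2.

Definition split_part (R : realType) (r p : nat) (P : {set {set 'I_r}}) :
    program R r {set {set 'I_r}} :=
  cands <~ mapP (fun W => X <~ queyranne R p W ;; Ret (X, W))
             [seq W : {set 'I_r} <- enum P | (1 < #|W|)%N] ;;
  XW <~ pick_min (fun XW : {set 'I_r} * {set 'I_r} =>
           u <~ sym_cut R p XW.2 XW.1 ;; v <~ ask_gamma R p XW.2 ;;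
           Ret (u - v)) cands ;;
  Ret (XW.1 |: ((XW.2 :\: XW.1) |: (P :\ XW.2)))%SET.

Definition gsa (R : realType) (r p : nat) : program R r {set {set 'I_r}} :=
  iterP p.-1 (split_part R p) [set [set: 'I_r]]%SET.

Definition eps_star (R : realType) (r : nat) (eps : R)
    (P : {set {set 'I_r}}) : program R r ({set 'I_r} -> R) :=
  gs <~ mapP (ask_gamma R #|P|) (enum P) ;;
  Ret (fun A => eps * nth 0 gs (index A (enum P)) / \sum_(g <- gs) g).

Definition efficient_step (R : realType) (r : nat) (eps beta : R)
    (st : {set {set 'I_r}} * R) (p : nat) :
    program R r ({set {set 'I_r}} * R) :=
  P <~ gsa R r p ;;
  e <~ eps_star eps P ;;
  v <~ ask_cost P e (fun=> beta / p%:R) ;;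
  Ret (if v < st.2 then (P, v) else st).

Definition efficient_partitioning (R : realType) (r : nat) (eps beta : R) :
    program R r ({set {set 'I_r}} * ({set 'I_r} -> R)) :=
  let P0 := [set [set: 'I_r]]%SET in
  v0 <~ ask_cost P0 (fun=> eps) (fun=> beta) ;;
  st <~ foldP (efficient_step eps beta) (P0, v0) (iota 2 r.-1) ;;
  e <~ eps_star eps st.1 ;;
  Ret (st.1, e).

(* Main.v *)
Require Import Defs.
From HB Require Import structures.
From mathcomp Require Import all_boot all_order all_algebra.
From mathcomp Require Import all_classical all_reals all_analysis.
From mathcomp Require Import fintype finset zify lra.

Set Implicit Arguments.
Unset Strict Implicit.
Unset Printing Implicit Defensive.

Import Order.TTheory GRing.Theory Num.Theory.
Import numFieldNormedType.Exports.

Local Open Scope set_scope.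
Local Open Scope ring_scope.

(** For a partition P of size p, the Cauchy-Schwarz inequality shows that the
    best split of the error bound eps is the balanced one, proportional to
    gamma, and that its cost is a constant times (sum of gamma over P) ^ 2
    ([best_cost_le], [balanced_split_cost]).  So it suffices to approximate,
    for each p, the least sum of gamma over partitions of size p within a
    factor 2 - 2 / p; the square of this factor is largest for p = r, and size
    1 is treated exactly ([approx_optimal_value]).

    The factor 2 - 2 / p is that of greedy splitting for monotone submodular
    functions.  If greedy splitting has reached a partition P and D is a family
    of disjoint sets, one fewer than P has parts and not covering everything,
    then the cost of P exceeds that of the ground set T by at most the sum of
    gamma(V) + gamma(T - V) - gamma(T) over V in D: by the pigeonhole
    principle two sets among those of D and the remainder meet the same part,
    so one of the sets of D suggests a split that is cheap by submodularity
    ([greedy_bound_split]).  With D an optimal partition minus its largest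
    part, monotonicity and subadditivity give the factor ([greedy_approx]).

    Each split is computed by Queyranne's algorithm.  It is exact because the
    last two groups of its order form a pendent pair: the last group is a
    cheapest set separating it from the last but one ([pendent_append],
    [pendent_cut]).  Hence merging them loses only sets that are no better
    than a recorded candidate ([run_queyranne]).

    Monotonicity of gamma rests on that of the support rank: each component
    f_j lies below the maximum, and a convex function bounded above on a line
    is constant there, so a direction in which a maximum of components is
    constant is one in which each of them is constant ([convex_bounded_const],
    [flat_spacesP], [support_rank_mono]).

    The programs are analysed by a Hoare logic in which a judgement bounds the
    cost of all executions together with the properties of their results
    ([bounded_run]).  Submodularity only enters as a premise inside
    postconditions, so the same analysis yields feasibility and the number of
    evaluations without it. *)

(** * Executions with a bounded number of evaluations *)

Section BoundedRuns.
Variables (Q S : Type) (ans : Q -> S) (cost : Q -> nat).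

(** The cost is bounded relative to whatever has been spent before, so that
    bounds add up when programs are sequenced. *)
Definition bounded_run (A : Type) (m : nat) (c : prog Q S A) (P : A -> Prop) :=
  forall k, every_run ans cost c k (fun a k' => P a /\ (k' <= k + m)%N).

Lemma every_run_weaken (A : Type) (c : prog Q S A) k (P P' : A -> nat -> Prop) :
  (forall a i, P a i -> P' a i) ->
  every_run ans cost c k P -> every_run ans cost c k P'.
Proof.
move=> PP'; elim: c k => [a|q c' IH|T l c' IH] k /=; first exact: PP'.
  exact: IH.
by move=> [l0 Hl]; split=> // t tl; apply: IH; apply: Hl.
Qed.

Lemma every_run_bind (A B : Type) (c : prog Q S A) (f : A -> prog Q S B) k P :
  every_run ans cost c k (fun a k' => every_run ans cost (f a) k' P) ->
  every_run ans cost (bind c f) k P.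
Proof.
elim: c k => [a|q c' IH|T l c' IH] k //=; first exact: IH.
by move=> [l0 Hl]; split=> // t tl; apply: IH; apply: Hl.
Qed.

Lemma bounded_run_ret (A : Type) m (a : A) (P : A -> Prop) :
  P a -> bounded_run m (Ret a) P.
Proof. by move=> Pa k /=; split=> //; rewrite leq_addr. Qed.

Lemma bounded_run_weaken (A : Type) m m' (c : prog Q S A) (P P' : A -> Prop) :
  (m <= m')%N -> (forall a, P a -> P' a) ->
  bounded_run m c P -> bounded_run m' c P'.
Proof.
move=> mm' PP' Hc k; apply: every_run_weaken (Hc k) => a i [Pa im].
by split; [exact: PP' | rewrite (leq_trans im) ?leq_add2l].
Qed.

Lemma bounded_run_bind (A B : Type) m m' (c : prog Q S A)
    (f : A -> prog Q S B) (P : A -> Prop) (P' : B -> Prop) :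
  bounded_run m c P -> (forall a, P a -> bounded_run m' (f a) P') ->
  bounded_run (m + m') (bind c f) P'.
Proof.
move=> Hc Hf k; apply: every_run_bind; apply: every_run_weaken (Hc k).
move=> a i [Pa im]; apply: every_run_weaken (Hf a Pa i) => b j [Pb jm].
by split=> //; lia.
Qed.

Lemma bounded_run_ask (A : Type) m q (f : S -> prog Q S A) (P : A -> Prop) :
  bounded_run m (f (ans q)) P -> bounded_run (cost q + m) (Ask q f) P.
Proof.
move=> Hf k /=; apply: every_run_weaken (Hf _) => a i [Pa im].
by split=> //; lia.
Qed.

Lemma bounded_run_pick_any (T : eqType) (l : seq T) :
  l <> [::] -> bounded_run 0 (pick_any l) (fun t => t \in l).
Proof. by move=> l0 k /=; split=> // t tl; split=> //; rewrite addn0. Qed.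

(** The list of pairs [z] records which result answers which argument, also
    when the arguments repeat or the results depend on arbitrary choices. *)
Lemma bounded_run_mapP (A : eqType) (B : Type) m (f : A -> prog Q S B)
    (l : seq A) (P : A -> B -> Prop) :
  (forall a, a \in l -> bounded_run m (f a) (P a)) ->
  bounded_run (size l * m) (Defs.mapP f l)
    (fun l' => exists z : seq (A * B),
       [/\ unzip1 z = l, unzip2 z = l' & forall i, (i < size l)%N ->
            forall d, P (nth d z i).1 (nth d z i).2]).
Proof.
elim: l => [|a l IH] Hl /=.
  by apply: bounded_run_ret; exists [::].
rewrite mulSn.
apply: (bounded_run_bind (P := P a)); first by apply: Hl; rewrite mem_head.
move=> b Pab; rewrite -[X in bounded_run X]addn0; apply: bounded_run_bind.
  by apply: IH => x xl; apply: Hl; rewrite inE xl orbT.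
move=> l' [z [z1 z2 Hz]]; apply: bounded_run_ret.
exists ((a, b) :: z); rewrite /= z1 z2; split=> //.
by move=> [|i] //= il d; apply: Hz.
Qed.

Lemma bounded_run_mapP_fun (A : eqType) (B : Type) m (f : A -> prog Q S B)
    (l : seq A) (h : A -> B) :
  (forall a, a \in l -> bounded_run m (f a) (fun b => b = h a)) ->
  bounded_run (size l * m) (Defs.mapP f l) (fun l' => l' = map h l).
Proof.
move=> /bounded_run_mapP; apply: bounded_run_weaken => // l' [z [<- <- Hz]].
elim: z Hz {l l'} => [|[a b] z IH] Hz //=.
have /= -> := Hz 0%N isT (a, b).
by congr cons; apply: IH => i il; apply: (Hz i.+1).
Qed.

(** The invariant sees the list of the elements already treated, most recent
    first, so that it can accumulate one guarantee per element. *)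
Lemma bounded_run_foldP (A : Type) (B : eqType) m (f : A -> B -> prog Q S A)
    (I : seq B -> A -> Prop) (l acc : seq B) z :
  I acc z ->
  (forall acc' z' b, b \in l -> I acc' z' ->
     bounded_run m (f z' b) (I (b :: acc'))) ->
  bounded_run (size l * m) (foldP f z l) (I (catrev l acc)).
Proof.
elim: l acc z => [|b l IH] acc z Iz Hf /=; first exact: bounded_run_ret.
rewrite mulSn; apply: bounded_run_bind.
  by apply: Hf Iz; rewrite mem_head.
move=> z' Iz'; apply: IH => // acc' z'' x xl; apply: Hf.
by rewrite inE xl orbT.
Qed.

Lemma bounded_run_iterP (A : Type) m n (f : A -> prog Q S A)
    (I : nat -> A -> Prop) z i :
  I i z ->
  (forall j z', (i <= j < i + n)%N -> I j z' -> bounded_run m (f z') (I j.+1)) ->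
  bounded_run (n * m) (iterP n f z) (I (i + n)%N).
Proof.
elim: n i z => [|n IH] i z Iz Hf /=.
  by rewrite addn0; apply: bounded_run_ret.
rewrite mulSn; apply: bounded_run_bind.
  by apply: Hf Iz; rewrite leqnn addnS ltnS leq_addr.
move=> z' Iz'; rewrite addnS -addSn; apply: IH => // j z'' /andP[ij jn].
by apply: Hf; rewrite (ltnW ij) addnS -addSn.
Qed.

Lemma bounded_run_pick_min (R : realType) (T : eqType) m
    (key : T -> prog Q S R) (h : T -> R) (l : seq T) :
  l <> [::] ->
  (forall t, t \in l -> bounded_run m (key t) (fun v => v = h t)) ->
  bounded_run (size l * m) (pick_min key l)
    (fun t => t \in l /\ forall u, u \in l -> h t <= h u).
Proof.
move=> l0 Hkey; rewrite -[(_ * m)%N]addn0.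
apply: (bounded_run_bind (P := fun l' => l' = [seq (t, h t) | t <- l])).
  apply: bounded_run_mapP_fun => t tl; rewrite -[m]addn0.
  apply: bounded_run_bind (Hkey t tl) _ => v ->.
  exact: bounded_run_ret.
(* the total order on R guarantees that some pair survives the filter *)
move=> l' ->; set sel := [seq _ <- _ | _].
have selP p : p \in sel -> p.1 \in l /\ forall u, u \in l -> h p.1 <= h u.
  rewrite mem_filter => /andP[/allP le_p /mapP[t tl pE]].
  rewrite pE in le_p *; split=> // u ul.
  by have := le_p (u, h u) (map_f _ ul).
rewrite -[0%N]addn0; apply: (bounded_run_bind (P := fun p => p \in sel)).
  apply: bounded_run_pick_any.
  case: l l0 @sel {Hkey selP} => [//|t0 l] _ sel selE.
  have [t tl tmin] : exists2 t, t \in t0 :: l &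
      forall u, u \in t0 :: l -> h t <= h u.
    elim: l t0 {sel selE} => [|t1 l IH] t0.
      by exists t0; rewrite ?mem_head // => u; rewrite inE => /eqP->.
    have [t tl tmin] := IH t1.
    have [le0|lt0] := leP (h t0) (h t).
      exists t0; rewrite ?mem_head // => u; rewrite inE => /orP[/eqP->//|ul].
      exact: le_trans le0 (tmin _ ul).
    exists t; first by rewrite inE tl orbT.
    move=> u; rewrite inE => /orP[/eqP->|/tmin//]; exact: ltW.
  have : (t, h t) \in sel.
    rewrite mem_filter map_f // andbT; apply/allP => q /mapP[u ul ->] /=.
    exact: tmin.
  by rewrite selE.
by move=> p /selP; apply: bounded_run_ret.
Qed.

End BoundedRuns.

(** * Submodular functions and pendent pairs *)

Section Submodular.
Variables (R : realType) (r : nat).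
Implicit Types (g : {set 'I_r} -> R) (W X Y Z : {set 'I_r}).

Definition submodular g := forall X Y, g (X :|: Y) + g (X :&: Y) <= g X + g Y.

(** Adding the elements of [Y :\: X] one at a time turns decreasing marginals
    into the lattice inequality. *)
Lemma submodular_setfunP g : submodular_setfun g -> submodular g.
Proof.
move=> gS X Y; have [n] := ubnP #|Y :\: X|.
elim: n Y => // n IH Y; have [YX|/subsetPn[j jY jX]] := boolP (Y \subset X).
  by move=> _; rewrite (setUidPl YX) (setIidPr YX).
have YE : j |: (Y :\ j) = Y by rewrite setD1K.
have jDYX : j \in Y :\: X by rewrite inE jX.
rewrite (cardsD1 j (Y :\: X)) jDYX setDDl setUC -setDDl => /IH {IH}.
have -> : X :&: (Y :\ j) = X :&: Y.
  by apply/setP=> x; rewrite !inE; case: eqVneq => // ->; rewrite (negPf jX).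
have jB : j \notin X :|: (Y :\ j) by rewrite !inE eqxx (negPf jX).
have := gS _ _ j (subsetUr X (Y :\ j)) jB.
rewrite setUCA YE; lra.
Qed.

Lemma submodular_subadd g X Y :
  submodular g -> (forall Z, 0 <= g Z) -> g (X :|: Y) <= g X + g Y.
Proof. by move=> gS g0; have := gS X Y; have := g0 (X :&: Y); lra. Qed.

(** As [g] may be positive on the empty set, the sum alone is not a bound when
    [D] is empty; the extra set [X] repairs this. *)
Lemma submodular_subadd_cover g X (D : {set {set 'I_r}}) :
  submodular g -> (forall Z, 0 <= g Z) ->
  g (X :|: cover D) <= g X + \sum_(V in D) g V.
Proof.
move=> gS g0; rewrite /cover.
elim/big_rec2: _ => [|V z Z _ IH]; first by rewrite setU0 addr0.
rewrite setUCA; apply: le_trans (submodular_subadd _ _ gS g0) _.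
by rewrite [leRHS]addrCA lerD2l.
Qed.

Definition cut g W X := g X + g (W :\: X).

Lemma cut_submodular g W : submodular g -> submodular (cut g W).
Proof.
move=> gS X Y; rewrite /cut setDUr setDIr.
have := gS X Y; have := gS (W :\: X) (W :\: Y); lra.
Qed.

Lemma cut_setD g W X : X \subset W -> cut g W (W :\: X) = cut g W X.
Proof. by move=> XW; rewrite /cut setDDr setDv set0U (setIidPr XW) addrC. Qed.

Definition groups_union (s : seq {set 'I_r}) : {set 'I_r} := \bigcup_(G <- s) G.

Lemma in_groups_union s x : (x \in groups_union s) = has (fun G : {set _} => x \in G) s.
Proof.
rewrite /groups_union; elim: s => [|G s IH]; first by rewrite big_nil inE.
by rewrite big_cons inE IH.
Qed.

Lemma groups_union_cons G s : groups_union (G :: s) = G :|: groups_union s.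
Proof. by rewrite /groups_union big_cons. Qed.

(** Counting memberships makes the notion invariant under permutations of the
    list and expresses covering and disjointness together. *)
Definition grouping W (s : seq {set 'I_r}) :=
  finset.set0 \notin s /\
  forall x, count (fun G : {set _} => x \in G) s = (x \in W).

Definition respects X (s : seq {set 'I_r}) :=
  all (fun G : {set 'I_r} => (G \subset X) || [disjoint G & X]) s.

Lemma respects_setD (A X : {set 'I_r}) s :
  groups_union s \subset A -> respects X s -> respects (A :\: X) s.
Proof.
move=> sA /allP sX; apply/allP => T Ts; have /orP[TX|TX] := sX T Ts.
  rewrite orbC disjoint_sym -setI_eq0 setIDAC; apply/orP; left.
  by rewrite setD_eq0 (subset_trans (subsetIr _ _)).
apply/orP; left; rewrite subsetD TX andbT (subset_trans _ sA) //.
by apply/subsetP=> x xT; rewrite in_groups_union; apply/hasP; exists T.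
Qed.

Lemma grouping_perm W s s' : perm_eq s s' -> grouping W s -> grouping W s'.
Proof.
move=> ss' [s0 sW]; split; first by rewrite -(perm_mem ss').
by move=> x; rewrite -(permP ss').
Qed.

Lemma grouping_cat_disjoint W s1 s2 x :
  grouping W (s1 ++ s2) -> x \in groups_union s1 -> x \in groups_union s2 = false.
Proof.
move=> [_ sW]; rewrite !in_groups_union !has_count => s1x.
have := sW x; rewrite count_cat; case: (x \in W); lia.
Qed.

Lemma grouping_union W s : grouping W s -> groups_union s = W.
Proof.
move=> [_ sW]; apply/setP=> x; rewrite in_groups_union has_count sW.
by case: (x \in W).
Qed.

Lemma grouping_singletons W : grouping W [seq [set x]%SET | x <- enum W].
Proof.
split; first by apply/mapP => -[x _ /setP/(_ x)]; rewrite !inE eqxx.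
move=> x; rewrite count_map (@eq_count _ _ (pred1 x)).
  by rewrite count_uniq_mem ?enum_uniq // mem_enum.
by move=> y /=; rewrite inE eq_sym.
Qed.

Lemma grouping_merge W U U' s :
  grouping W (U :: U' :: s) -> grouping W ((U :|: U') :: s).
Proof.
move=> [s0 sW]; split.
  move: s0; rewrite !inE !negb_or => /and3P[U0 _ ->]; rewrite andbT.
  apply: contraNneq U0 => UU; rewrite eq_sym -subset0 UU; exact: subsetUl.
move=> x; have := sW x; rewrite /= inE.
by case: (x \in U); case: (x \in U'); case: (x \in W); lia.
Qed.

(** Queyranne's invariant, with the most recent group first in [ord].  Once
    everything but one group [U] has been ordered, so that the complement of
    [U] is [groups_union ord], it says for symmetric [h] that [U] is cheapest
    among the unions of groups separating it from the most recent group. *)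
Definition pendent (h : {set 'I_r} -> R) (ord rest : seq {set 'I_r}) :=
  forall U X, U \in rest -> respects X ord -> X \subset groups_union (behead ord) ->
  h (groups_union ord) + h U <= h (groups_union ord :\: X) + h (X :|: U).

Lemma pendent1 h G rest : pendent h [:: G] rest.
Proof.
move=> U X _ _; rewrite /groups_union big_nil subset0 => /eqP->.
by rewrite setD0 set0U.
Qed.

(** Only the most recent group [G] can prevent the invariant for the previous
    order from applying to [X].  If [X] avoids [G], it applies to [X] and
    submodularity adds the new group [U].  If [X] contains [G], it applies to
    the complement of [X] in the ordered part with [U] as the remaining group,
    and the choice of [U] allows [U] to be exchanged for [V]. *)
Lemma pendent_append h W ord rest U :
  submodular h -> ord <> [::] -> grouping W (ord ++ rest) -> U \in rest ->
  (forall V, V \in rest -> h (groups_union ord :|: U) - h U <=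
                           h (groups_union ord :|: V) - h V) ->
  pendent h ord rest -> pendent h (U :: ord) (rem U rest).
Proof.
move=> hS; case: ord => [//|G older] _ gW Urest Umin IH V X Vrest /=.
set A := groups_union (G :: older) => /andP[_ Xresp] XA.
have {}Vrest : V \in rest by apply: mem_rem Vrest.
have disj T x : T \in rest -> ~~ ((x \in A) && (x \in T)).
  move=> Tr; apply/negP => /andP[/(grouping_cat_disjoint gW)].
  by rewrite in_groups_union => /negbT/hasPn/(_ T Tr)/negPf->.
have inA x : (x \in X) ==> (x \in A) by apply/implyP/subsetP.
rewrite groups_union_cons -/A.
have [GX|nGX] := boolP (G \subset X).
  have Xc : respects (A :\: X) (G :: older) by apply: respects_setD.
  have Xo : A :\: X \subset groups_union older.
    rewrite /A groups_union_cons; apply/subsetP=> x; rewrite !inE.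
    by have /subsetP/(_ x) := GX; case: (x \in G) => [->//|_ /andP[]].
  have := IH U _ Urest Xc Xo; rewrite -/A.
  have -> : A :\: (A :\: X) = X.
    by rewrite setDDr setDv set0U (setIidPr XA).
  have -> : (A :\: X) :|: U = (U :|: A) :\: X.
    apply/setP=> x; rewrite !inE; have := disj U x Urest.
    have := inA x.
    by case: (x \in X); case: (x \in A); case: (x \in U) .
  have := hS (X :|: V) A; have -> : X :|: V :|: A = A :|: V.
    by rewrite setUAC (setUidPr XA).
  have -> : (X :|: V) :&: A = X.
    apply/setP=> x; rewrite !inE; have := disj V x Vrest.
    have := inA x.
    by case: (x \in X); case: (x \in A); case: (x \in V) .
  have := Umin V Vrest; rewrite -/A [U :|: A]setUC; lra.
have Xo : X \subset groups_union older.
  have GX : [disjoint G & X].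
    by have := Xresp; rewrite /= (negPf nGX) => /andP[].
  apply/subsetP=> x xX; have /subsetP/(_ x xX) := XA.
  by rewrite /A groups_union_cons inE (disjointFl GX xX).
have := IH V X Vrest Xresp Xo; rewrite -/A.
have := hS ((U :|: A) :\: X) A; have -> : ((U :|: A) :\: X) :|: A = U :|: A.
  apply/setP=> x; rewrite !inE; have := disj U x Urest.
  have := inA x.
  by case: (x \in X); case: (x \in A); case: (x \in U) .
have -> : ((U :|: A) :\: X) :&: A = A :\: X.
  apply/setP=> x; rewrite !inE.
  by case: (x \in X); case: (x \in A); case: (x \in U).
lra.
Qed.

(** This justifies merging the last two groups: a set that stops being a union
    of groups separates [U] from [U'], and the recorded candidate [U] is at
    least as good. *)
Lemma pendent_cut g W U U' s Y :
  grouping W (U :: U' :: s) -> pendent (cut g W) (U' :: s) [:: U] ->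
  respects Y (U :: U' :: s) -> ~~ respects Y ((U :|: U') :: s) -> Y \subset W ->
  cut g W U <= cut g W Y.
Proof.
(* by symmetry of the cut, [Y] may be replaced by its complement in [W] *)
move=> gW Hp; wlog UY : Y / U \subset Y => [wl|] Yr nY YW.
  have [UY|nUY] := boolP (U \subset Y); first exact: wl.
  have sW := grouping_union gW.
  have WYr : respects (W :\: Y) (U :: U' :: s) by apply: respects_setD; rewrite ?sW.
  rewrite -(cut_setD g YW); apply: wl => //; last exact: subsetDl.
    have := Yr; rewrite /= (negPf nUY) /= => /andP[UY _].
    by rewrite subsetD UY andbT -sW groups_union_cons subsetUl.
  apply: contra nY => /(@respects_setD W); rewrite setDDr setDv set0U (setIidPr YW).
  by apply; rewrite groups_union_cons -setUA -!groups_union_cons sW.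
have disj x : x \in U -> x \in groups_union (U' :: s) = false.
  move=> xU; apply: (@grouping_cat_disjoint W [:: U]) => //.
  by rewrite groups_union_cons inE xU.
have UA : U :|: groups_union (U' :: s) = W.
  by rewrite -groups_union_cons (grouping_union gW).
set A := groups_union (U' :: s) in disj UA.
have UW : U \subset W by rewrite -UA subsetUl.
have AE : A = W :\: U.
  apply/setP=> x; rewrite -UA !inE; have := disj x.
  by case: (x \in U) => //= ->.
have YU' : [disjoint U' & Y].
  move: Yr nY; rewrite /= UY /= => /andP[/orP[U'Y|//] sY].
  by rewrite subUset UY U'Y sY.
have Xr : respects (Y :\: U) (U' :: s).
  apply/allP => T Ts.
  have TU : [disjoint T & U].
    rewrite disjoint_subset; apply/subsetP=> x xT; rewrite inE; apply/negP => /disj.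
    by rewrite /A in_groups_union => /negbT/hasPn/(_ T Ts); rewrite xT.
  have /allP/(_ T) := Yr; rewrite inE Ts orbT => /(_ isT) /orP[TY|TY].
    by rewrite subsetD TY TU.
  by rewrite orbC (disjointWr _ TY) ?subsetDl.
have Xs : Y :\: U \subset groups_union s.
  apply/subsetP=> x; rewrite inE => /andP[xU xY].
  have := subsetP YW x xY; rewrite -UA inE (negPf xU) /= /A groups_union_cons inE.
  by rewrite (disjointFl YU' xY).
have := Hp U _ (mem_head _ _) Xr Xs; rewrite -/A AE (cut_setD g UW).
have -> : W :\: U :\: (Y :\: U) = W :\: Y.
  by rewrite setDDl setDUr setDDr; apply/setP=> x; rewrite !inE;
     have /subsetP/(_ x) := UY; case: (x \in U) => [->|] //=;
     case: (x \in Y); case: (x \in W).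
by rewrite (cut_setD g YW) setDE setUIl [~: _ :|: _]setUC setUCr setIT (setUidPl UY); lra.
Qed.

End Submodular.

(** * Greedy splitting of partitions *)

Section GreedySplitting.
Variables (R : realType) (r : nat).
Implicit Types (g : {set 'I_r} -> R) (W X V : {set 'I_r}) (P Q D : {set {set 'I_r}}).

Lemma partition_trivial : (0 < r)%N ->
  partition [set [set: 'I_r]]%SET [set: 'I_r]%SET.
Proof.
move=> r0; apply/and3P; split; [by rewrite cover1|exact: trivIset1|].
by rewrite inE eq_sym; apply/set0Pn; exists (Ordinal r0); rewrite inE.
Qed.

Lemma partition_setT_neq0 P : (0 < r)%N ->
  partition P [set: 'I_r]%SET -> P != finset.set0.
Proof.
move=> r0 PT; apply/eqP => PE; have := cover_partition PT.
by rewrite PE /cover big_set0 => /setP/(_ (Ordinal r0)); rewrite !inE.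
Qed.

Lemma partition_card_le P : partition P [set: 'I_r]%SET -> (#|P| <= r)%N.
Proof.
move=> PT; have := card_partition PT; rewrite cardsT card_ord => rE.
rewrite [leqRHS]rE -sum1_card; apply: leq_sum => A AP; rewrite card_gt0.
exact: partition_neq0 PT AP.
Qed.

Definition splits X W := (X != finset.set0) && (X \proper W).

Definition split_at P W X : {set {set 'I_r}} := X |: ((W :\: X) |: (P :\ W)).

Lemma split_at_partition P W X T :
  partition P T -> W \in P -> splits X W -> partition (split_at P W X) T.
Proof.
move=> PT WP /andP[X0 /properP[XW [y yW yX]]].
have WT := partitionS PT WP.
have -> : T = X :|: ((W :\: X) :|: (T :\: W)).
  apply/setP=> x; rewrite !inE.
  have /implyP := subsetP XW x; have /implyP := subsetP WT x.
  by case: (x \in X); case: (x \in W); case: (x \in T).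
have WX0 : W :\: X != finset.set0 by apply/set0Pn; exists y; rewrite inE yX.
have dWX : [disjoint W :\: X & T :\: W].
  rewrite -setI_eq0; apply/eqP/setP=> x; rewrite !inE.
  by case: (x \in X); case: (x \in W).
have dX : [disjoint X & (W :\: X) :|: (T :\: W)].
  rewrite -setI_eq0; apply/eqP/setP=> x; rewrite !inE.
  have := subsetP XW x.
  by case: (x \in X) => //= ->.
exact: (partitionU1 (partitionU1 (partitionD1 PT WP) WX0 dWX) X0 dX).
Qed.

Lemma split_at_notin P W X T :
  partition P T -> W \in P -> splits X W ->
  X \notin (W :\: X) |: (P :\ W) /\ W :\: X \notin P :\ W.
Proof.
move=> PT WP /andP[X0 /properP[XW [y yW yX]]].
have tP := trivIsetP (partition_trivIset PT).
have notin Y : Y != finset.set0 -> Y \subset W -> Y \notin P :\ W.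
  move=> Y0 YW; rewrite !inE; apply/negP => /andP[YneW YP].
  have := tP _ _ YP WP YneW; rewrite -setI_eq0 (setIidPl YW).
  by rewrite (negPf Y0).
split.
  rewrite in_setU1 negb_or notin // andbT.
  apply: contraNneq X0 => XE; have : X :&: X = finset.set0.
    by rewrite {1}XE; apply/setP=> x; rewrite !inE; case: (x \in X); rewrite ?andbF.
  by rewrite setIid => /eqP.
apply: notin; last exact: subsetDl.
by apply/set0Pn; exists y; rewrite inE yX.
Qed.

Lemma split_at_sum g P W X T :
  partition P T -> W \in P -> splits X W ->
  \sum_(A in split_at P W X) g A = \sum_(A in P) g A + (cut g W X - g W).
Proof.
move=> PT WP XW; have [n1 n2] := split_at_notin PT WP XW.
rewrite /split_at !big_setU1 //= [in RHS](big_setD1 W) //= /cut; lra.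
Qed.

Lemma split_at_card P W X T :
  partition P T -> W \in P -> splits X W -> #|split_at P W X| = #|P|.+1.
Proof.
move=> PT WP XW; have [n1 n2] := split_at_notin PT WP XW.
by rewrite /split_at !cardsU1 n1 n2 (cardsD1 W P) WP.
Qed.

Definition excess g V : R := g V + g (~: V) - g [set: 'I_r]%SET.

(** The cost of greedy splitting is bounded by the excesses of every family of
    disjoint sets of the right size.  Leaving the last part of a competing
    partition out of [D] makes the condition hereditary in [D], which is what
    the induction on the number of splits uses. *)
Definition greedy_bound g P := forall D,
  trivIset D -> finset.set0 \notin D -> cover D != [set: 'I_r]%SET ->
  #|D|.+1 = #|P| ->
  \sum_(A in P) g A <= g [set: 'I_r]%SET + \sum_(V in D) excess g V.

Lemma greedy_bound1 g : greedy_bound g [set [set: 'I_r]]%SET.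
Proof.
move=> D _ _ _; rewrite cards1 => -[] /eqP; rewrite cards_eq0 => /eqP->.
by rewrite big_set1 big_set0 addr0.
Qed.

(** Two applications of submodularity: intersecting a cut of the ground set
    with [W] does not increase the gain. *)
Lemma split_gain_le_excess g V W :
  submodular g -> cut g W (V :&: W) - g W <= excess g V.
Proof.
move=> gS; rewrite /cut /excess; have := gS V W; have := gS (~: V) (V :|: W).
have -> : ~: V :|: (V :|: W) = [set: 'I_r]%SET.
  by rewrite setUA [~: V :|: V]setUC setUCr setTU.
have -> : ~: V :&: (V :|: W) = W :\: (V :&: W).
  by apply/setP=> x; rewrite !inE; case: (x \in V); case: (x \in W).
lra.
Qed.

Lemma pigeonhole_partition P D :
  partition P [set: 'I_r]%SET -> finset.set0 \notin D -> (#|P| < #|D|)%N ->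
  exists W V V', [/\ W \in P, V \in D, V' \in D, V != V' &
    (V :&: W != finset.set0) && (V' :&: W != finset.set0)].
Proof.
move=> PT D0 PD.
pose f V := if [pick x in V] is Some x then pblock P x else finset.set0.
have fP V : V \in D -> f V \in P /\ V :&: f V != finset.set0.
  move=> VD; rewrite /f; case: pickP => [x xV|V0]; last first.
    by case/negP: D0; rewrite (_ : finset.set0 = V) //; apply/setP=> x; rewrite V0 inE.
  have xP : x \in cover P by rewrite (cover_partition PT) inE.
  split; first exact: pblock_mem.
  by apply/set0Pn; exists x; rewrite inE xV mem_pblock.
have /dinjectivePn[V VD [V' /andP[/= V'V V'D] fE]] : ~~ dinjectiveb f (mem D).
  apply: contraL PD => /dinjectiveP /card_in_imset <-; rewrite -leqNgt.
  by apply: subset_leq_card; apply/subsetP=> _ /imsetP[V VD ->]; case: (fP V VD).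
exists (f V), V, V'; have [fV ->] := fP V VD.
by rewrite fE; have [_ ->] := fP V' V'D; rewrite -fE eq_sym.
Qed.

(** The sets in [D] together with the remainder [~: cover D] are one more than
    the parts of [P], so two of them meet the same part [W'], and one of these
    two, [V], belongs to [D].  Cutting [V :&: W'] off [W'] is a possible split,
    hence the greedy one costs at most the excess of [V]; the hypothesis on [P]
    pays for the rest of [D]. *)
Lemma greedy_bound_split g P W X :
  submodular g -> partition P [set: 'I_r]%SET -> W \in P -> splits X W ->
  (forall W' X', W' \in P -> splits X' W' ->
     cut g W X - g W <= cut g W' X' - g W') ->
  greedy_bound g P -> greedy_bound g (split_at P W X).
Proof.
move=> gS PT WP XW gain_min gP D tD D0 covD cardD.
rewrite (split_at_sum g PT WP XW).
have step W' V V' : W' \in P -> V \in D -> [disjoint V & V'] ->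
    V :&: W' != finset.set0 -> V' :&: W' != finset.set0 ->
    \sum_(A in P) g A + (cut g W X - g W) <=
      g [set: 'I_r]%SET + \sum_(U in D) excess g U.
  move=> W'P VD VV' VW' /set0Pn[y]; rewrite inE => /andP[yV' yW'].
  have VW's : splits (V :&: W') W'.
    rewrite /splits VW' properE subsetIr; apply/subsetPn; exists y => //.
    by rewrite inE (disjointFl VV' yV').
  have := gain_min _ _ W'P VW's; have := split_gain_le_excess V W' gS.
  rewrite (big_setD1 V VD) /=.
  have := gP (D :\ V) (trivIsetS (subD1set _ _) tD).
  rewrite inE negb_and D0 orbT => /(_ isT).
  have -> : cover (D :\ V) != [set: 'I_r]%SET.
    rewrite (coverD1 tD VD); apply: contraNneq VW' => /setP cE.
    apply/eqP/setP=> x; have := cE x.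
    by rewrite !inE => /andP[/negPf->].
  have -> : #|D :\ V|.+1 = #|P|.
    by move: cardD; rewrite (cardsD1 V D) VD add1n (split_at_card PT WP XW) => -[].
  move=> /(_ isT erefl); lra.
have cD0 : ~: cover D != finset.set0.
  by apply: contraNneq covD => cE; rewrite -(setCK (cover D)) cE setC0.
have [tD' cD'] : trivIset (~: cover D |: D) /\ ~: cover D \notin D.
  apply: trivIsetU1 => // B BD; rewrite -setI_eq0; apply/eqP/setP=> x.
  rewrite !inE; apply/negP => /andP[/negP xD xB]; apply: xD.
  by apply/bigcupP; exists B.
have [||W' [V [V' [W'P VD V'D VV' /andP[VW' V'W']]]]] :=
    @pigeonhole_partition P (~: cover D |: D) PT.
- by rewrite !inE negb_or eq_sym cD0.
- by rewrite cardsU1 cD' add1n cardD (split_at_card PT WP XW).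
have dis := trivIsetP tD' _ _ VD V'D VV'.
move: VD; rewrite !inE => /orP[VE|VD]; last exact: step VD dis VW' V'W'.
move: V'D; rewrite !inE => /orP[V'E|V'D].
  by rewrite (eqP VE) (eqP V'E) eqxx in VV'.
by apply: step V'D _ V'W' VW' => //; rewrite disjoint_sym.
Qed.

Lemma exists_max g Q : Q != finset.set0 ->
  exists2 V, V \in Q & forall U, U \in Q -> g U <= g V.
Proof.
move=> /set0Pn[V0 V0Q]; case: (arg_maxP g V0Q) => V VQ Vmax.
by exists V.
Qed.

(** The bound is applied to [Q] without its largest part [Z].  For the second
    largest part [Y], the term [g (~: Y)] is bounded by subadditivity, which
    yields the whole cost of [Q] once; for the other parts the last two terms
    of the excess do not contribute by monotonicity.  As [Y] and [Z] are the
    largest parts, the other ones account for at most a fraction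
    [1 - 2 / #|Q|] of the cost of [Q]. *)
Lemma greedy_approx g P Q :
  submodular g -> monotone_setfun g -> (forall A, 0 <= g A) ->
  partition Q [set: 'I_r]%SET -> #|Q| = #|P| -> (2 <= #|P|)%N ->
  greedy_bound g P ->
  \sum_(A in P) g A <= (2 - 2 / #|P|%:R) * \sum_(A in Q) g A.
Proof.
move=> gS gM g0 QT QP P2 gP.
have cov := cover_partition QT; have tQ := partition_trivIset QT.
have Q0 : finset.set0 \notin Q by rewrite (partition0 QT).
have [|Z ZQ Zmax] := @exists_max g Q; first by rewrite -card_gt0; lia.
have cardQZ : #|Q :\ Z|.+1 = #|P| by rewrite -QP (cardsD1 Z Q) ZQ.
have [|Y YQ Ymax] := @exists_max g (Q :\ Z); first by rewrite -card_gt0; lia.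
have cardQZY : #|Q :\ Z :\ Y|.+2 = #|P|.
  by rewrite -cardQZ (cardsD1 Y (Q :\ Z)) YQ.
have YQ' : Y \in Q by move: YQ; rewrite inE => /andP[].
have YZ : Y != Z by move: YQ; rewrite !inE => /andP[].
have Z0 : Z != finset.set0 := partition_neq0 QT ZQ.
have := gP (Q :\ Z) (trivIsetS (subD1set _ _) tQ).
rewrite inE negb_and Q0 orbT => /(_ isT).
have -> : cover (Q :\ Z) != [set: 'I_r]%SET.
  rewrite (coverD1 tQ ZQ) cov; apply: contraNneq Z0 => /setP cE.
  by apply/eqP/setP=> x; have := cE x; rewrite !inE andbT => /negPf.
move=> /(_ isT cardQZ).
rewrite (big_setD1 Z ZQ) (big_setD1 Y YQ) (big_setD1 Y YQ) /=.
set S := \sum_(V in Q :\ Z :\ Y) g V.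
have gY : g (~: Y) <= g Z + S.
  apply: le_trans (submodular_subadd_cover _ _ gS g0); apply: gM.
  apply/subsetP=> x; rewrite !inE => xY.
  have : x \in cover Q by rewrite cov inE.
  move=> /bigcupP[B BQ xB]; have [<-|BZ] := eqVneq B Z; first by rewrite xB.
  apply/orP; right; apply/bigcupP; exists B => //.
  by rewrite !inE BZ BQ !andbT; apply: contraNneq xY => <-.
have exS : \sum_(V in Q :\ Z :\ Y) excess g V <= S.
  apply: ler_sum => V _; rewrite /excess.
  have := gM _ _ (finset.subsetT (~: V)); lra.
have SY : S <= (#|P|%:R - 2) * g Y.
  rewrite -cardQZY -addn2 natrD addrK mulr_natl -sumr_const.
  by apply: ler_sum => V; rewrite inE => /andP[_ /Ymax].
have YZle : g Y <= g Z by apply: Zmax.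
have p2 : (2 : R) <= #|P|%:R by rewrite ler_nat.
have p0 : (0 : R) < #|P|%:R by lra.
rewrite {1}/excess => bound.
have {bound} : \sum_(A in P) g A <= g Z + g Y + 2 * S by lra.
move=> /le_trans; apply.
rewrite -(ler_pM2l p0) mulrA mulrBr [_ * (2 / _)]mulrCA mulfV ?gt_eqF //.
nra.
Qed.

End GreedySplitting.

(** * Queyranne's algorithm and greedy splitting as programs *)

Section AlgorithmSpecs.
Variables (R : realType) (r p : nat) (g : {set 'I_r} -> R) (ans : query R r -> R).
Hypothesis ansE : forall A, ans (QGamma p A) = g A.
Implicit Types (W X Y U : {set 'I_r}) (P : {set {set 'I_r}}).

Local Notation run := (bounded_run ans (@query_cost R r)).

Lemma run_ask_gamma A : run 1 (ask_gamma R p A) (fun v => v = g A).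
Proof.
rewrite -[X in bounded_run _ _ X]addn0.
apply: (@bounded_run_ask _ _ _ _ _ 0 (QGamma p A)).
by apply: bounded_run_ret; rewrite ansE.
Qed.

Lemma run_sym_cut W X : run 2 (sym_cut R p W X) (fun v => v = cut g W X).
Proof.
apply: (bounded_run_bind (m := 1) (m' := 1)); first exact: run_ask_gamma.
move=> u ->; apply: (bounded_run_bind (m := 1) (m' := 0)); first exact: run_ask_gamma.
by move=> v ->; apply: bounded_run_ret.
Qed.

(** Queyranne's invariant is needed for the state before the last group was
    appended, when that group was still the only one left; the same invariant
    for the current state is what carries the induction. *)
Definition order_invariant W groups n (st : seq {set 'I_r} * seq {set 'I_r}) :=
  [/\ st.1 <> [::], perm_eq (st.1 ++ st.2) groups, size st.1 = n.+1 &
    submodular g -> pendent (cut g W) st.1 st.2 /\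
      pendent (cut g W) (behead st.1) (head finset.set0 st.1 :: st.2)].

Lemma run_append_group W groups n st :
  grouping W groups -> (n.+1 < size groups)%N -> order_invariant W groups n st ->
  run (size groups * 4) (append_group R p W st) (order_invariant W groups n.+1).
Proof.
case: st => [ord rest] gW; rewrite /order_invariant /= => nlt [ord0 perm szo pend].
have szr := perm_size perm; rewrite size_cat szo in szr.
rewrite -[X in bounded_run _ _ X]addn0.
pose key U := cut g W (groups_union ord :|: U) - cut g W U.
apply: (bounded_run_bind (P := fun U => U \in rest /\
    forall V, V \in rest -> key U <= key V)).
  apply: (@bounded_run_weaken _ _ _ _ _ (size rest * 4)); last first.
  - apply: bounded_run_pick_min; first by case: (rest) szr => //=; lia.
    move=> U _; apply: (bounded_run_bind (m := 2) (m' := 2)); first exact: run_sym_cut.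
    move=> u ->; apply: (bounded_run_bind (m := 2) (m' := 0)); first exact: run_sym_cut.
    by move=> v ->; apply: bounded_run_ret.
  - by [].
  - by rewrite leq_mul2r -szr leq_addl orbT.
move=> U [Ur Umin]; apply: bounded_run_ret; rewrite /=; split=> //.
- rewrite -(permPr perm) perm_sym (perm_trans (y := ord ++ U :: rem U rest)) //.
    by rewrite perm_cat2l perm_to_rem.
  by rewrite -cat1s perm_catCA.
- by rewrite szo.
move=> gS; have [pend1 _] := pend gS; split.
  have gW' : grouping W (ord ++ rest) by apply: grouping_perm gW; rewrite perm_sym.
  exact: (@pendent_append _ _ _ W ord rest U (cut_submodular W gS) ord0 gW' Ur Umin pend1).
move=> V X Vr; apply: pend1; move: Vr; rewrite inE => /orP[/eqP->//|].
exact: mem_rem.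
Qed.

Lemma run_order_groups W groups :
  grouping W groups -> groups <> [::] ->
  run (size groups * (size groups * 4)) (order_groups R p W groups)
    (fun ord => perm_eq ord groups /\
       (submodular g -> pendent (cut g W) (behead ord) [:: head finset.set0 ord])).
Proof.
move=> gW groups0; have sz0 : (0 < size groups)%N by case: (groups) groups0.
apply: (@bounded_run_weaken _ _ _ _ _ (0 + ((size groups).-1 * (size groups * 4) + 0))).
- by rewrite add0n addn0 leq_mul2r leq_pred orbT.
- by move=> a H; exact: H.
apply: bounded_run_bind; first exact: bounded_run_pick_any groups0.
move=> G Gg; apply: bounded_run_bind.
  apply: (@bounded_run_iterP _ _ _ _ _ _ _ _ (order_invariant W groups) _ 0).
    split=> //=; first by rewrite perm_sym perm_to_rem.
    move=> gS; split; first exact: pendent1.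
    by move=> U X _ _; rewrite /= /groups_union big_nil subset0 => /eqP->;
      rewrite setD0 set0U.
  by move=> n st /andP[_ nlt] inv; apply: run_append_group inv => //; lia.
move=> [ord rest] [/= ord0 perm szo pend].
have rest0 : rest = [::].
  apply/size0nil; have := perm_size perm.
  by rewrite size_cat szo prednK // -[RHS]addn0 => /addnI.
apply: bounded_run_ret; rewrite rest0 cats0 in perm pend *; split=> //.
by move=> /pend[].
Qed.

(** A set that splits [W] either is still a union of groups or is no cheaper
    than a recorded candidate.  When a single group is left, no set that splits
    [W] is a union of groups. *)
Definition merge_invariant W n (st : seq {set 'I_r} * seq {set 'I_r}) :=
  [/\ grouping W st.1, (size st.1 + n = #|W|)%N, size st.2 = n,
      (forall U, U \in st.2 -> splits U W) &
      submodular g -> forall Y, splits Y W ->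
        respects Y st.1 \/ exists2 U, U \in st.2 & cut g W U <= cut g W Y].

Lemma run_merge_step W n st :
  (n.+1 < #|W|)%N -> merge_invariant W n st ->
  run (r * (r * 4)) (merge_step R p W st) (merge_invariant W n.+1).
Proof.
case: st => [groups cands]; rewrite /merge_invariant /= => nlt [gW szg szc candsW best].
have gr : (size groups <= r)%N.
  by rewrite (leq_trans (leq_addr n _)) // szg -[leqRHS]card_ord max_card.
have g1 : (1 < size groups)%N by rewrite -(ltn_add2r n) szg.
rewrite -[X in bounded_run _ _ X]addn0.
apply: bounded_run_bind.
  apply: bounded_run_weaken (run_order_groups gW _).
  - by apply: leq_mul; rewrite ?leq_mul2r.
  - by move=> a H; exact: H.
  - by move=> gE; rewrite gE in g1.
move=> ord [perm pend]; apply: bounded_run_ret; move: g1.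
have sz := perm_size perm; rewrite -sz.
case: ord perm pend sz => [|U [|U' s]] //= perm pend sz _.
have gW' : grouping W (U :: U' :: s) by apply: grouping_perm gW; rewrite perm_sym.
have Usplit : splits U W.
  have [s0 _] := gW'; move: s0; rewrite !inE !negb_or => /and3P[U0 U'0 _].
  rewrite /splits eq_sym U0 /=; have /set0Pn[x xU'] : U' != finset.set0 by rewrite eq_sym.
  have UW : U \subset W by rewrite -(grouping_union gW') groups_union_cons subsetUl.
  have U'W : U' \subset W.
    by rewrite -(grouping_union gW') !groups_union_cons setUCA subsetUl.
  rewrite properE UW; apply/subsetPn; exists x; first exact: (subsetP U'W).
  apply/negP => xU.
  have := @grouping_cat_disjoint _ W [:: U] (U' :: s) x gW'.
  by rewrite !in_groups_union /= xU xU' => /(_ isT).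
split=> //.
- exact: grouping_merge.
- by rewrite /= -szg -sz !addSn addnS.
- by rewrite /= szc.
- by move=> V; rewrite inE => /orP[/eqP->//|]; apply: candsW.
move=> gS Y YW; have [resp|[V Vc VY]] := best gS Y YW; last first.
  by right; exists V => //; rewrite inE Vc orbT.
have [?|nresp] := boolP (respects Y ((U :|: U') :: s)); first by left.
right; exists U; first exact: mem_head.
apply: pendent_cut gW' (pend gS) _ nresp _.
  by rewrite /respects (perm_all _ perm).
by case/andP: YW => _ /proper_sub.
Qed.

Lemma run_queyranne W :
  (1 < #|W|)%N ->
  run (r * (r * (r * 4)) + r * 2) (queyranne R p W)
    (fun X => splits X W /\
       (submodular g -> forall Y, splits Y W -> cut g W X <= cut g W Y)).
Proof.
move=> W1; have Wr : (#|W| <= r)%N by rewrite -[leqRHS]card_ord max_card.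
apply: bounded_run_bind.
  apply: (@bounded_run_weaken _ _ _ _ _ (#|W|.-1 * (r * (r * 4))));
    [|move=> st inv; exact: inv|].
    by rewrite leq_mul2r; lia.
  apply: (@bounded_run_iterP _ _ _ _ _ _ _ _ (merge_invariant W) _ 0).
    split=> //=; first exact: grouping_singletons.
      by rewrite size_map -cardE addn0.
    move=> _ Y _; left; apply/allP => _ /mapP[x _ ->].
    by rewrite sub1set disjoints1; case: (x \in Y).
  by move=> n st /andP[_ nlt]; apply: run_merge_step; lia.
move=> [groups cands] [/= gW + + candsW best]; rewrite add0n => szg szc.
have {}szg : size groups = 1%N.
  by apply: (@addIn #|W|.-1); rewrite szg add1n prednK // ltnW.
have c0 : (0 < size cands)%N by rewrite szc -subn1 subn_gt0.
apply: (@bounded_run_weaken _ _ _ _ _ (size cands * 2)); last first.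
- apply: bounded_run_pick_min => [|X _]; last exact: run_sym_cut.
  by move=> cE; rewrite cE in c0.
- move=> X [Xc Xmin]; split; first exact: candsW.
  move=> gS Y YW; have [resp|[U Uc UY]] := best gS Y YW; last first.
    exact: le_trans (Xmin _ Uc) UY.
  have := grouping_union gW; case: groups szg {gW best} resp => [|G [|? ?]] //=.
  rewrite andbT groups_union_cons /groups_union big_nil setU0 => _ + GW.
  have /andP[Y0 YprW] := YW; rewrite GW => /orP[WY|].
    by have := proper_subn YprW; rewrite WY.
  rewrite -setI_eq0 setIC (setIidPl (proper_sub YprW)) => Y0'.
  by rewrite Y0' in Y0.
- by rewrite leq_mul2r szc (leq_trans (leq_pred _) Wr) orbT.
Qed.

Definition split_evals := (r * ((r * (r * (r * 4)) + r * 2)) + r * 3)%N.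

Lemma run_split_part P :
  partition P [set: 'I_r]%SET -> (#|P| < r)%N ->
  run split_evals (split_part R p P)
    (fun P' => exists W X, [/\ P' = split_at P W X, W \in P, splits X W &
       submodular g -> forall W' X', W' \in P -> splits X' W' ->
         cut g W X - g W <= cut g W' X' - g W']).
Proof.
move=> PT Pr; set l := [seq W : {set 'I_r} <- enum P | (1 < #|W|)%N].
have lP W : W \in l = (W \in P) && (1 < #|W|)%N by rewrite mem_filter mem_enum andbC.
have szl : (size l <= r)%N.
  rewrite size_filter (leq_trans (count_size _ _)) // -cardE.
  exact: partition_card_le.
have l0 : l <> [::].
  move=> lE; move: Pr; rewrite ltnNge => /negP; apply.
  have := card_partition PT; rewrite cardsT card_ord => rE.
  rewrite [leqLHS]rE -sum1_card; apply: leq_sum => A AP; rewrite leqNgt; apply/negP => A1.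
  by have := lP A; rewrite lE AP A1.
pose spec W (XW : {set 'I_r} * {set 'I_r}) := [/\ XW.2 = W, splits XW.1 W &
  submodular g -> forall Y, splits Y W -> cut g W XW.1 <= cut g W Y].
apply: (bounded_run_bind (P := fun cands : seq ({set 'I_r} * {set 'I_r}) =>
   [/\ size cands = size l, forall XW, XW \in cands -> exists2 W, W \in l & spec W XW &
    forall W, W \in l -> exists2 XW, XW \in cands & spec W XW])).
  apply: (@bounded_run_weaken _ _ _ _ _ (size l * (r * (r * (r * 4)) + r * 2))); last first.
  - apply: (@bounded_run_mapP _ _ _ _ _ _ _ _ _ spec) => W.
    rewrite lP => /andP[WP W1].
    rewrite -[X in bounded_run _ _ X]addn0; apply: bounded_run_bind.
      exact: run_queyranne W1.
    by move=> X [XW Xmin]; apply: bounded_run_ret.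
  - move=> cands [z [zl zc Hz]].
    have szz : size z = size l by rewrite -zl size_map.
    split; first by rewrite -zc size_map.
    + move=> XW; rewrite -zc => /(nthP (finset.set0, finset.set0))[i].
      rewrite size_map => il <-; exists (nth (finset.set0) l i).
        by rewrite mem_nth // -szz.
      rewrite -[l in nth _ l i]zl !(nth_map (finset.set0, (finset.set0, finset.set0))) //.
      by apply: Hz; rewrite -szz.
    + move=> W /(nthP finset.set0)[i il <-].
      exists (nth (finset.set0, finset.set0) cands i).
        by rewrite mem_nth // -zc size_map szz.
      rewrite -[l in nth _ l i]zl -zc.
      rewrite !(nth_map (finset.set0, (finset.set0, finset.set0))) ?szz //.
      exact: Hz.
  - by rewrite leq_mul2r szl orbT.
move=> cands [szc candsl lcands]; rewrite -[(r * 3)%N]addn0.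
pose key (XW : {set 'I_r} * {set 'I_r}) := cut g XW.2 XW.1 - g XW.2.
apply: (bounded_run_bind (P := fun XW => XW \in cands /\
    forall XW', XW' \in cands -> key XW <= key XW')).
  apply: (@bounded_run_weaken _ _ _ _ _ (size cands * 3)); last first.
  - apply: bounded_run_pick_min; first by case: (cands) (l) l0 szc => [|? ?] [].
    move=> XW _; apply: (bounded_run_bind (m := 2) (m' := 1)); first exact: run_sym_cut.
    move=> u ->; apply: (bounded_run_bind (m := 1) (m' := 0)); first exact: run_ask_gamma.
    by move=> v ->; apply: bounded_run_ret.
  - by [].
  - by rewrite leq_mul2r; lia.
move=> [X W] [XWc XWmin]; apply: bounded_run_ret; exists W, X.
have [V Vl [/= WV XV _]] := candsl _ XWc; subst V.
split=> //; first by move: Vl; rewrite lP => /andP[].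
move=> gS W' X' W'P X'W'.
have W'l : W' \in l.
  rewrite lP W'P; have /andP[X'0 X'pr] := X'W'.
  by rewrite (leq_trans _ (proper_card X'pr)) // ltnS card_gt0.
have [[Y V] YVc [/= VW' _ Ymin]] := lcands W' W'l; subst V.
have := XWmin _ YVc; rewrite /key /= => /le_trans; apply.
by rewrite lerD2r Ymin.
Qed.

Definition gsa_evals := (r * split_evals)%N.

Lemma run_gsa :
  (0 < p <= r)%N ->
  run gsa_evals (gsa R r p)
    (fun P => [/\ partition P [set: 'I_r]%SET, #|P| = p &
       submodular g -> greedy_bound g P]).
Proof.
move=> /andP[p0 pr].
apply: (@bounded_run_weaken _ _ _ _ _ (p.-1 * split_evals)); last first.
- apply: (@bounded_run_iterP _ _ _ _ _ _ _ _ (fun n P =>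
    [/\ partition P [set: 'I_r]%SET, #|P| = n.+1 &
      submodular g -> greedy_bound g P]) _ 0).
    split; last by move=> _; apply: greedy_bound1.
      exact: partition_trivial (leq_trans p0 pr).
    by rewrite cards1.
  move=> n P nlt [PT Pn gP]; apply: bounded_run_weaken (run_split_part PT _) => //.
    move=> _ [W [X [-> WP XW Xmin]]]; split.
    - exact: split_at_partition.
    - by rewrite (split_at_card PT WP XW) Pn.
    - by move=> gS; apply: greedy_bound_split => //; [exact: Xmin | exact: gP].
  by rewrite Pn; lia.
- by move=> P [PT Pn gP]; split=> //; rewrite Pn; lia.
- by rewrite leq_mul2r; lia.
Qed.

End AlgorithmSpecs.

(** * Monotonicity of the support rank *)

Section ConvexOnSubspace.
Variables (R : realType) (n : nat).
Implicit Types (f : 'rV[R]_n -> R) (L : {vspace 'rV[R]_n}).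

Lemma convex_function_le f (t : R) x y :
  convex_function [set: 'rV[R]_n]%classic f -> 0 <= t -> t <= 1 ->
  f (t *: x + (1 - t) *: y) <= t * f x + (1 - t) * f y.
Proof.
move=> fC t0 t1; apply: (fC (Itv01 t0 t1) x y); exact: mem_set.
Qed.

Lemma convex_midpoint f x v w :
  convex_function [set: 'rV[R]_n]%classic f ->
  f (x + v + w) <= (f (x + (v *+ 2)) + f (x + (w *+ 2))) / 2.
Proof.
move=> fC; have h0 : 0 <= 2^-1 :> R by lra.
have h1 : 2^-1 <= 1 :> R by lra.
have := convex_function_le (x + (v *+ 2)) (x + (w *+ 2)) fC h0 h1.
have -> : 1 - 2^-1 = 2^-1 :> R by lra.
rewrite -scalerDr addrACA -mulr2n -!mulrnDl -(scaler_nat 2 (_ + _)) scalerA mulVf ?pnatr_eq0 //.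
rewrite scale1r addrA; lra.
Qed.

(** A convex function that is bounded above on a line is constant on it: on
    the segment from [x] to the far point [x + t^-1 *: v], an increase at
    [x + v] would propagate linearly beyond the bound. *)
Lemma convex_bounded_const f L x (M : R) :
  convex_function [set: 'rV[R]_n]%classic f ->
  (forall v, v \in L -> f (x + v) <= M) -> forall v, v \in L -> f (x + v) = f x.
Proof.
move=> fC fM.
have le v : v \in L -> f (x + v) <= f x.
  move=> vL; rewrite leNgt; apply/negP => fv.
  have Mf : 0 < M - f x by rewrite subr_gt0 (lt_le_trans fv) // fM.
  (* at [x + t^-1 *: v] the extrapolated increase is twice [M - f x] *)
  pose t := (f (x + v) - f x) / (2 * (M - f x)).
  have t0 : 0 < t by rewrite divr_gt0 ?mulr_gt0 // subr_gt0.
  have tE : t * (M - f x) = (f (x + v) - f x) / 2.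
    by rewrite /t invfM mulrA -mulrA mulVf ?mulr1 // gt_eqF.
  have t1 : t <= 1.
    rewrite -(ler_pM2r Mf) tE mul1r; have := fM v vL; move: fv; lra.
  have := convex_function_le (x + t^-1 *: v) x fC (ltW t0) t1.
  have -> : t *: (x + t^-1 *: v) + (1 - t) *: x = x + v.
    rewrite scalerDr scalerA mulfV ?gt_eqF // scale1r addrAC -scalerDl.
    by rewrite [t + (1 - t)]addrCA subrr addr0 scale1r.
  have := fM (t^-1 *: v) (memvZ _ vL); nra.
move=> v vL; apply/eqP; rewrite eq_le le //=.
have := convex_midpoint x (2^-1 *: v) (- (2^-1 *: v)) fC.
have vE : 2^-1 *: v *+ 2 = v.
  by rewrite -(scaler_nat 2 (_ *: _)) scalerA mulfV ?pnatr_eq0 // scale1r.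
rewrite addrK mulNrn vE; have := le (- v); rewrite memvN => /(_ vL); lra.
Qed.

Lemma convex_const_add f L1 L2 x :
  convex_function [set: 'rV[R]_n]%classic f ->
  (forall v, v \in L1 -> f (x + v) = f x) -> (forall v, v \in L2 -> f (x + v) = f x) ->
  forall v, v \in (L1 + L2)%VS -> f (x + v) = f x.
Proof.
move=> fC f1 f2; apply: (@convex_bounded_const _ _ _ (f x)) => //.
move=> _ /memv_addP[v vL [w wL ->]].
rewrite addrA; apply: le_trans (convex_midpoint x v w fC) _.
by rewrite f1 ?f2 ?rpredMn //; lra.
Qed.

End ConvexOnSubspace.

Section SupportRank.
Variables (R : realType) (n b r : nat) (d : measure_display).
Variables (W : measurableType d) (C : ccp R n b r W).
Implicit Types (A B : {set 'I_r}) (L : {vspace 'rV[R]_n}).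

(** Each [f_j] lies below the maximum, hence is bounded, hence constant, along
    every direction in which the maximum is constant.  Flatness of the maximum
    is therefore a condition on the components separately; this is what makes
    the support rank monotone, and the maximal flat space unique. *)
Lemma flat_spacesP A L :
  flat_spaces C A L <-> forall j x y w, j \in A -> ccp_dom C (x, y) ->
    forall v, v \in L -> ccp_constr C (x + v) y w ord0 j = ccp_constr C x y w ord0 j.
Proof.
split=> [flat j x y w jA xy|flat x y w xy v vL]; last first.
  by apply: eq_bigr => j jA; rewrite (flat j x y w jA xy v vL).
have fC := @ccp_constr_convex _ _ _ _ _ _ C y w j (ex_intro _ x xy).
apply: (convex_bounded_const (M := \sum_(i in A) `|ccp_constr C x y w ord0 i|) fC).
move=> v vL; rewrite -lee_fin.
apply: le_trans (_ : (max_constr C A (x + v) y w <= _)%E).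
  exact: (@le_bigmax_cond _ _ _ _ j (mem A)
    (fun i => (ccp_constr C (x + v) y w ord0 i)%:E)).
rewrite (flat x y w xy v vL); apply: bigmax_le; first exact: leNye.
move=> i iA; rewrite lee_fin (bigD1 i) //= (le_trans (ler_norm _)) // lerDl.
exact: sumr_ge0.
Qed.

Lemma flat_spaces_add A L1 L2 :
  flat_spaces C A L1 -> flat_spaces C A L2 -> flat_spaces C A (L1 + L2)%VS.
Proof.
move=> /flat_spacesP f1 /flat_spacesP f2; apply/flat_spacesP => j x y w jA xy.
have fC := @ccp_constr_convex _ _ _ _ _ _ C y w j (ex_intro _ x xy).
exact: (convex_const_add fC (f1 j x y w jA xy) (f2 j x y w jA xy)).
Qed.

Lemma max_flat_spaceP A :
  flat_spaces C A (max_flat_space C A) /\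
  forall L, flat_spaces C A L -> (L <= max_flat_space C A)%VS.
Proof.
have flat0 : flat_spaces C A 0%VS.
  by apply/flat_spacesP => j x y w _ _ v; rewrite memv0 => /eqP->; rewrite addr0.
have [flatM maxM] : [set L | flat_spaces C A L /\
    forall L', flat_spaces C A L' -> (L <= L')%VS -> L' = L]%classic (max_flat_space C A).
  apply: xgetPex.
  pose Q k := `[< exists2 L, flat_spaces C A L & \dim L = k >].
  have exQ : exists k, Q k.
    by exists (\dim (0%VS : {vspace 'rV[R]_n})); apply/asboolP; exists 0%VS.
  have ubQ k : Q k -> (k <= \dim {: 'rV[R]_n})%N.
    by move=> /asboolP[L _ <-]; exact: dimvS (subvf L).
  case: (ex_maxnP exQ ubQ) => k /asboolP[L flatL <-] maxk.
  exists L; split=> // L' flatL' LL'; apply/esym/eqP; rewrite eqEdim LL' /=.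
  by apply: maxk; apply/asboolP; exists L'.
split=> // L flatL.
by rewrite -(maxM _ (flat_spaces_add flatM flatL) (addvSl _ _)) addvSr.
Qed.

Lemma support_rank_mono A B : A \subset B -> (support_rank C A <= support_rank C B)%N.
Proof.
move=> AB; rewrite /support_rank; have [//|A0] := eqVneq A finset.set0.
have [B0|_] := eqVneq B finset.set0; first by move: AB A0; rewrite B0 subset0 => ->.
apply: leq_sub2l; apply: dimvS; apply: (max_flat_spaceP A).2.
have /flat_spacesP flatB := (max_flat_spaceP B).1.
by apply/flat_spacesP => j x y w /(subsetP AB); apply: flatB.
Qed.

End SupportRank.

(** * Optimal costs for a given partition *)

Section CostAnalysis.
Variables (R : realType) (n b r : nat) (d : measure_display).
Variables (W : measurableType d) (C : ccp R n b r W) (beta : R) (nu : {set 'I_r} -> R).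
Hypotheses (beta_gt0 : 0 < beta) (beta_lt : beta < 1 / expR 1).
Hypotheses (nu_ge0 : forall A, 0 <= nu A) (nu_mono : monotone_setfun nu).
Hypothesis nu1_gt0 : forall j : 'I_r, 0 < nu [set j]%SET.
Implicit Types (A B : {set 'I_r}) (P : {set {set 'I_r}}).

Local Notation gam := (gamma C nu beta).
Local Notation sig := (sigma C nu beta).
Local Notation eps := (ccp_eps C).

Lemma log_gt1 p : (0 < p)%N -> 1 < ln (2 ^+ b * p%:R / beta).
Proof.
move=> p0; have e0 : 0 < expR 1 :> R := expR_gt0 1.
have : expR 1 < 2 ^+ b * p%:R / beta.
  rewrite ltr_pdivlMr // mulrC; apply: lt_le_trans (_ : 1 <= _).
    by rewrite -ltr_pdivlMr.
  rewrite -[leLHS]mulr1; apply: ler_pM => //; first by rewrite exprn_ege1 // ler1n.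
  by rewrite ler1n.
by move=> lt; rewrite -[ltLHS]expRK ltr_ln ?posrE // (lt_trans e0 lt).
Qed.

Lemma rate_gt0 p A : (0 < p)%N ->
  0 < ln (2 ^+ b * p%:R / beta) + (support_rank C A)%:R - 1.
Proof. by move=> /log_gt1; have := ler0n R (support_rank C A); lra. Qed.

Lemma sigma_ge0 p A : (0 < p)%N -> 0 <= sig p A.
Proof. by move=> p0; rewrite mulr_ge0 // ltW // rate_gt0. Qed.

Lemma sigma_gt0 p A : (0 < p)%N -> A != finset.set0 -> 0 < sig p A.
Proof.
move=> p0 /set0Pn[j jA]; rewrite mulr_gt0 ?rate_gt0 //.
by rewrite (lt_le_trans (nu1_gt0 j)) // nu_mono // sub1set.
Qed.

Lemma gamma_gt0 p A : (0 < p)%N -> A != finset.set0 -> 0 < gam p A.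
Proof. by move=> p0 A0; rewrite sqrtr_gt0 sigma_gt0. Qed.

Lemma gamma_mono p : (0 < p)%N -> monotone_setfun (gam p).
Proof.
move=> p0 A B AB; rewrite ler_wsqrtr // ler_pM //; last exact: nu_mono.
  by rewrite ltW // rate_gt0.
by rewrite lerD2r lerD2l ler_nat support_rank_mono.
Qed.

Definition prefactor : R := expR 1 / (expR 1 - 1).

Lemma prefactor_gt0 : 0 < prefactor.
Proof. by rewrite divr_gt0 ?expR_gt0 // subr_gt0 expR_gt1. Qed.

Definition gamma_sum p P : R := \sum_(A in P) gam p A.

(** The least cost of [P] over all splits of [eps], see [best_cost_le] and
    [balanced_split_cost]. *)
Definition best_cost p P : R := prefactor / eps * gamma_sum p P ^+ 2.

Lemma sampling_costE P (e : {set 'I_r} -> R) (p : nat) : (0 < p)%N ->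
  sampling_cost C nu P e (fun=> beta / p%:R) =
    prefactor * \sum_(A in P) sig p A / e A.
Proof.
move=> p0; rewrite /sampling_cost -/prefactor; congr (_ * _); apply: eq_bigr => A _.
by rewrite /sigma invf_div mulrA mul1r -mulrA mulrC.
Qed.

Lemma gamma_sum_gt0 p P : (0 < p)%N -> partition P [set: 'I_r]%SET -> P != finset.set0 ->
  0 < gamma_sum p P.
Proof.
move=> p0 PT /set0Pn[A AP]; rewrite /gamma_sum (bigD1 A) //=.
rewrite ltr_pwDl ?gamma_gt0 ?(partition_neq0 PT AP) //.
by apply: sumr_ge0 => B _; exact: sqrtr_ge0.
Qed.

(** Cauchy-Schwarz, obtained by summing over [A] the tangent line inequality
    for [gamma A ^+ 2 / e A] at the common optimal ratio [c = gamma A / e A]. *)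
Lemma best_cost_le p P (e : {set 'I_r} -> R) :
  (0 < p)%N -> (forall A, A \in P -> 0 < e A) -> \sum_(A in P) e A <= eps ->
  best_cost p P <= prefactor * \sum_(A in P) sig p A / e A.
Proof.
move=> p0 e_gt0 e_sum; rewrite /best_cost -mulrA ler_pM2l ?prefactor_gt0 //.
have eps0 := ccp_eps_gt0 C; set T := gamma_sum p P.
pose c := T / eps.
have T0 : 0 <= T by apply: sumr_ge0 => A _; exact: sqrtr_ge0.
have tangent A : A \in P -> 2 * c * gam p A - c ^+ 2 * e A <= sig p A / e A.
  move=> AP; have eA := e_gt0 A AP; rewrite ler_pdivlMr //.
  rewrite -(sqr_sqrtr (sigma_ge0 A p0)) -/(gam p A).
  have := sqr_ge0 (gam p A - c * e A); nra.
have : \sum_(A in P) (2 * c * gam p A - c ^+ 2 * e A) <= \sum_(A in P) sig p A / e A.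
  exact: ler_sum.
rewrite big_split /= sumrN -!mulr_sumr -/(gamma_sum p P) -/T; apply: le_trans.
have cE : T = c * eps by rewrite /c -mulrA mulVf ?mulr1 // gt_eqF.
have -> : eps^-1 * T ^+ 2 = c ^+ 2 * eps.
  by rewrite cE exprMn mulrCA [eps ^+ 2]expr2 mulKf // gt_eqF.
have : c ^+ 2 * \sum_(A in P) e A <= c ^+ 2 * eps by rewrite ler_wpM2l ?sqr_ge0.
rewrite cE; nra.
Qed.

Definition balanced_split P (e : {set 'I_r} -> R) :=
  forall A, A \in P -> e A = eps * gam #|P| A / gamma_sum #|P| P.

Lemma balanced_split_cost P e :
  partition P [set: 'I_r]%SET -> P != finset.set0 -> balanced_split P e ->
  sampling_cost C nu P e (fun=> beta / #|P|%:R) = best_cost #|P| P.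
Proof.
move=> PT P0 eP; have p0 : (0 < #|P|)%N by rewrite card_gt0.
have T0 := gamma_sum_gt0 p0 PT P0; have eps0 := ccp_eps_gt0 C.
rewrite sampling_costE // /best_cost -mulrA; congr (_ * _).
rewrite expr2 mulrA {2}/gamma_sum mulr_sumr; apply: eq_bigr => A AP.
have g0 := gamma_gt0 p0 (partition_neq0 PT AP).
rewrite eP // -(sqr_sqrtr (sigma_ge0 A p0)) -/(gam #|P| A).
move: (gam #|P| A) (gamma_sum _ _) eps g0 T0 eps0 => x t a x0 t0 a0.
rewrite invf_div expr2 -[in LHS]mulrA [x * (t / _)]mulrCA invfM.
rewrite [x * (a^-1 * _)]mulrCA mulfV ?gt_eqF //.
by rewrite mulr1 mulrC [t * _]mulrC.
Qed.

Lemma balanced_split_feasible P e :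
  partition P [set: 'I_r]%SET -> P != finset.set0 -> balanced_split P e ->
  feasible C (P, e).
Proof.
move=> PT P0 eP; have p0 : (0 < #|P|)%N by rewrite card_gt0.
have T0 := gamma_sum_gt0 p0 PT P0; have eps0 := ccp_eps_gt0 C.
split=> //=.
  move=> A AP; rewrite eP // divr_gt0 ?mulr_gt0 //.
  exact: gamma_gt0 p0 (partition_neq0 PT AP).
rewrite (eq_bigr _ eP) -mulr_suml -mulr_sumr -/(gamma_sum _ _).
by rewrite -mulrA mulfV ?mulr1 // gt_eqF.
Qed.

Lemma partition1_setT P :
  partition P [set: 'I_r]%SET -> #|P| = 1%N -> P = [set [set: 'I_r]]%SET.
Proof.
move=> PT /eqP/cards1P[A PE]; have := cover_partition PT.
by rewrite PE cover1 => ->.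
Qed.

(** The guarantee for partitions of size [p] gets worse as [p] grows, so the
    one for [p = r] is valid for all sizes. *)
Lemma approx_optimal_value (v : R) : (2 <= r)%N ->
  v <= best_cost 1 [set [set: 'I_r]]%SET ->
  (forall p Q, (2 <= p <= r)%N -> partition Q [set: 'I_r]%SET -> #|Q| = p ->
     v <= (2 - 2 / p%:R) ^+ 2 * best_cost p Q) ->
  v <= (2 - 2 / r%:R) ^+ 2 * optimal_value C nu beta.
Proof.
move=> r2 v1 vp; have r0 : (0 : R) < r%:R by rewrite ltr0n; lia.
have eps0 := ccp_eps_gt0 C.
pose k p : R := 2 - 2 / p%:R.
have k1 : 1 <= k r.
  by rewrite /k; have : 2 / r%:R <= 1 :> R by [rewrite ler_pdivrMr // mul1r ler_nat]; lra.
have k0 : 0 < k r ^+ 2 by rewrite exprn_gt0 // (lt_le_trans _ k1).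
rewrite mulrC -ler_pdivrMr //; apply: lb_le_inf.
  pose T1 : {set {set 'I_r}} := [set [set: 'I_r]]%SET.
  exists (objective C nu beta (T1, fun=> eps)), (T1, fun=> eps) => //.
  by split=> //=; [exact: partition_trivial (ltnW r2) | rewrite big_set1].
move=> _ [[Q e] [/= QT e_gt0 e_sum] <-]; rewrite ler_pdivrMr // mulrC.
have Q0 := partition_setT_neq0 (ltnW r2) QT.
have p0 : (0 < #|Q|)%N by rewrite card_gt0.
have Qr := partition_card_le QT.
rewrite /objective /= sampling_costE //.
have := best_cost_le p0 e_gt0 e_sum; set X := prefactor * _ => bX.
have b0 : 0 <= best_cost #|Q| Q.
  by rewrite mulr_ge0 ?sqr_ge0 // divr_ge0 // ltW // prefactor_gt0.
apply: le_trans (_ : k r ^+ 2 * best_cost #|Q| Q <= _); last by rewrite ler_pM2l.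
have [Q1|Q1] := eqVneq #|Q| 1%N.
  rewrite Q1 (partition1_setT QT Q1) in b0 *; apply: le_trans v1 _.
  by rewrite -[leLHS]mul1r ler_wpM2r // exprn_ege1.
have Q2 : (2 <= #|Q| <= r)%N by rewrite Qr andbT ltn_neqAle eq_sym Q1.
apply: le_trans (vp _ Q Q2 QT erefl) _; rewrite ler_wpM2r //.
have q0 : (0 : R) < #|Q|%:R by rewrite ltr0n.
rewrite ler_pXn2r // ?nnegrE.
- rewrite lerD2l lerN2 ler_pM2l // lef_pV2 ?posrE // ler_nat //.
- have : 2 / #|Q|%:R <= 1 :> R by [rewrite ler_pdivrMr // mul1r ler_nat; case/andP: Q2]; lra.
- lra.
Qed.

End CostAnalysis.

(** * The efficient partitioning algorithm *)

Section EfficientPartitioning.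
Variables (R : realType) (n b r : nat) (d : measure_display).
Variables (W : measurableType d) (C : ccp R n b r W) (beta : R) (nu : {set 'I_r} -> R).
Hypotheses (r_ge2 : (2 <= r)%N).
Hypotheses (beta_gt0 : 0 < beta) (beta_lt : beta < 1 / expR 1).
Hypotheses (nu_ge0 : forall A, 0 <= nu A) (nu_mono : monotone_setfun nu).
Hypothesis nu1_gt0 : forall j : 'I_r, 0 < nu [set j]%SET.
Implicit Types (A B : {set 'I_r}) (P : {set {set 'I_r}}).

Local Notation gam := (gamma C nu beta).
Local Notation eps := (ccp_eps C).
Local Notation best := (best_cost C beta nu).
Local Notation trivial_partition := [set [set: 'I_r]]%SET.
Local Notation run := (bounded_run (answer C nu beta) (@query_cost R r)).

Lemma run_eps_star P :
  partition P [set: 'I_r]%SET -> run r (eps_star eps P) (balanced_split C beta nu P).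
Proof.
move=> PT; apply: (@bounded_run_weaken _ _ _ _ _ (size (enum P) * 1 + 0)).
- by rewrite addn0 muln1 -cardE partition_card_le.
- by move=> e H; exact: H.
apply: bounded_run_bind.
  by apply: bounded_run_mapP_fun => A _; exact: run_ask_gamma.
move=> _ ->; apply: bounded_run_ret => A AP.
rewrite (nth_map finset.set0) ?index_mem ?mem_enum // nth_index ?mem_enum //.
by rewrite big_map big_enum.
Qed.

Definition best_so_far (ps : seq nat) (st : {set {set 'I_r}} * R) :=
  [/\ partition st.1 [set: 'I_r]%SET, st.2 = best #|st.1| st.1,
      st.2 <= best 1 trivial_partition &
      forall p, p \in ps -> submodular (gam p) ->
        forall Q, partition Q [set: 'I_r]%SET -> #|Q| = p ->
          st.2 <= (2 - 2 / p%:R) ^+ 2 * best p Q].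

Lemma run_efficient_step ps st p :
  (2 <= p <= r)%N -> best_so_far ps st ->
  run (gsa_evals r + (r + r)) (efficient_step eps beta st p) (best_so_far (p :: ps)).
Proof.
case: st => [P v] /andP[p2 pr] [/= PT vE v1 vps].
have p0 : (0 < p)%N by apply: leq_trans p2.
apply: bounded_run_bind; first by apply: (run_gsa (g := gam p)) => //; rewrite p0.
move=> P' [PT' P'p gP']; apply: bounded_run_bind; first exact: run_eps_star.
move=> e eP'; rewrite -[X in bounded_run _ _ X]addn0.
have P'0 : P' != finset.set0 by rewrite -card_gt0 P'p.
apply: (@bounded_run_weaken _ _ _ _ _ (#|P'| + 0)); [|move=> s H; exact: H|].
  by rewrite leq_add2r P'p.
apply: (@bounded_run_ask _ _ _ _ _ 0 (QCost P' e (fun=> beta / p%:R))).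
apply: bounded_run_ret => /=; rewrite -P'p.
rewrite (balanced_split_cost beta_gt0 beta_lt nu_ge0 nu_mono nu1_gt0 PT' P'0 eP').
have key : submodular (gam p) -> forall Q, partition Q [set: 'I_r]%SET -> #|Q| = p ->
    best #|P'| P' <= (2 - 2 / p%:R) ^+ 2 * best p Q.
  move=> gS Q QT Qp; rewrite /best_cost [leRHS]mulrCA -exprMn ler_pM2l; last first.
    by rewrite divr_gt0 ?prefactor_gt0 // ccp_eps_gt0.
  have := greedy_approx gS (gamma_mono C beta_gt0 beta_lt nu_ge0 nu_mono p0)
    (fun A => sqrtr_ge0 _) QT.
  rewrite Qp => /(_ P' (esym P'p)); rewrite P'p => /(_ p2 (gP' gS)) le.
  rewrite ler_pXn2r // nnegrE.
    by apply: sumr_ge0 => A _; exact: sqrtr_ge0.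
  by apply: le_trans le; apply: sumr_ge0 => A _; exact: sqrtr_ge0.
rewrite P'p in key; case: ltP => [lt|ge]; split=> //=.
- by apply: le_trans v1; exact: ltW.
- move=> q; rewrite inE P'p => /orP[/eqP->|qps] gS Q QT Qq.
    exact: key.
  by rewrite (le_trans _ (vps q qps gS Q QT Qq)) // -{1}P'p ltW.
- move=> q; rewrite inE P'p => /orP[/eqP->|qps] gS Q QT Qq; last exact: vps.
  by rewrite (le_trans ge) // P'p key.
Qed.

Definition total_evals := (1 + (r * (gsa_evals r + (r + r)) + r))%N.

Lemma run_efficient_partitioning :
  run total_evals (efficient_partitioning r eps beta)
    (fun s => feasible C s /\
      ((forall p, (2 <= p <= r)%N -> submodular (gam p)) ->
        objective C nu beta s <= (2 - 2 / r%:R) ^+ 2 * optimal_value C nu beta)).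
Proof.
have eps0 := ccp_eps_gt0 C; have r0 : (0 < r)%N := ltnW r_ge2.
have T0 : trivial_partition != finset.set0.
  by rewrite -card_gt0 cards1.
(* with a single part, the balanced split gives it all of [eps] *)
have v0E : sampling_cost C nu trivial_partition (fun=> eps) (fun=> beta) =
    best 1 trivial_partition.
  have -> : (fun=> beta : R) = (fun=> beta / #|trivial_partition|%:R) :> ({set 'I_r} -> R).
    by apply/funext => A; rewrite cards1 divr1.
  have -> := balanced_split_cost (e := fun=> eps) beta_gt0 beta_lt nu_ge0 nu_mono
    nu1_gt0 (partition_trivial r0) T0; first by rewrite cards1.
  move=> A; rewrite inE => /eqP->; rewrite /gamma_sum cards1 big_set1 -mulrA mulfV ?mulr1 //.
  rewrite gt_eqF // (gamma_gt0 _ beta_gt0) //.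
  by rewrite (partition_neq0 (partition_trivial r0)) // inE.
apply: (@bounded_run_bind _ _ _ _ _ _ 1 _ _ _ (fun v => v = best 1 trivial_partition)).
  apply: (@bounded_run_weaken _ _ _ _ _ (#|trivial_partition| + 0));
    [by rewrite cards1|move=> v vE; exact: vE|].
  apply: (@bounded_run_ask _ _ _ _ _ 0 (QCost trivial_partition (fun=> eps) (fun=> beta))).
  by apply: bounded_run_ret; exact: v0E.
move=> _ ->; apply: bounded_run_bind.
  apply: (@bounded_run_weaken _ _ _ _ _ (size (iota 2 r.-1) * (gsa_evals r + (r + r))));
    [|move=> st inv; exact: inv|].
    by rewrite size_iota leq_mul2r leq_pred orbT.
  apply: (@bounded_run_foldP _ _ _ _ _ _ _ _ best_so_far _ [::]).
    by split=> //=; [exact: partition_trivial | rewrite cards1].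
  move=> ps st p; rewrite mem_iota => /andP[p2 pr] inv.
  by apply: run_efficient_step inv; rewrite p2; lia.
move=> [P v] [/= PT vE v1 vps]; rewrite -[r in run r]addn0.
apply: bounded_run_bind; first exact: run_eps_star.
move=> e eP; apply: bounded_run_ret.
have P0 := partition_setT_neq0 r0 PT.
split; first by apply: (balanced_split_feasible (beta := beta) (nu := nu)).
move=> gS; rewrite /objective /=.
rewrite (balanced_split_cost beta_gt0 beta_lt nu_ge0 nu_mono nu1_gt0 PT P0 eP) -vE.
apply: (approx_optimal_value beta_gt0 beta_lt nu_ge0 r_ge2 v1) => p Q pr QT Qp.
apply: vps => //; last exact: gS.
rewrite -/(rev _) mem_rev mem_iota; lia.
Qed.

End EfficientPartitioning.

Theorem theorem3 :
  exists q : {poly nat},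
  forall (R : realType) (n b r : nat) (d : measure_display)
    (W : measurableType d) (C : ccp R n b r W)
    (beta : R) (nu : {set 'I_r} -> R),
    (2 <= r)%N ->
    0 < beta -> beta < 1 / expR 1 ->
    (forall A, 0 <= nu A) -> monotone_setfun nu -> modular_setfun nu ->
    (forall j : 'I_r, 0 < nu [set j]%SET) ->
    every_run (answer C nu beta) (@query_cost R r)
      (efficient_partitioning r (ccp_eps C) beta) 0
      (fun s evals =>
         [/\ feasible C s,
             (evals <= q.[r])%N
           & (forall p, (2 <= p <= r)%N -> submodular_setfun (gamma C nu beta p)) ->
             objective C nu beta s
               <= (2 - 2 / r%:R) ^+ 2 * optimal_value C nu beta]).
Proof.
(* [total_evals] with ['X] in place of [r] *)
pose X : {poly nat} := 'X; pose c (k : nat) : {poly nat} := k%:P.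
pose split_poly := X * (X * (X * (X * c 4%N)) + X * c 2%N) + X * c 3%N.
exists (c 1%N + (X * (X * split_poly + (X + X)) + X)).
move=> R n b r d W C beta nu r2 beta0 beta_lt nu0 nuM _ nu1.
have qE : (c 1%N + (X * (X * split_poly + (X + X)) + X)).[r] = total_evals r.
  by rewrite !(hornerD, hornerM, hornerX, hornerC).
rewrite qE; have := run_efficient_partitioning C r2 beta0 beta_lt nu0 nuM nu1 0.
apply: every_run_weaken => s k [[sF sO] kle]; split=> // gS; apply: sO => p pr.
exact: submodular_setfunP (gS p pr).
Qed.
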